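(* Let $p>3$ be prime, $a,b\in\mathbb{Q}_p$, $ab\ne0$, $(a,b)\in\Delta$. Write $N_A$ for the number of roots (with multiplicity) of $x^3+ax=b$ lying in $A\subset\mathbb{Q}_p$. Then, in each listed case: $N_{\mathbb{Z}_p^*}$ equals: $3$ if $|a|_p<|b|_p=1$, $p\equiv1\ (3)$, $\sqrt[3]{b}$ exists; $3$ if $|a|_p=|b|_p=1$, $0\le|D|_p<1$, $\sqrt{D}$ exists; $3$ if $|a|_p=|b|_p=1$, $|D|_p=1$, $D_0u_{p-2}^2\equiv0\ (p)$; $2$ if $|b|_p<|a|_p=1$, $\sqrt{-a}$ exists; $1$ if $|a|_p<|b|_p=1$, $p\equiv2\ (3)$, $\sqrt[3]{b}$ exists; $1$ if $|a|_p=|b|_p=1$, $0<|D|_p<1$, $\sqrt D$ does not exist; $1$ if $|a|_p=|b|_p=1$, $|D|_p=1$, $D_0u_{p-2}^2\not\equiv0,9a_0^2\ (p)$; $1$ if $|a|_p=|b|_p>1$. $N_{\mathbb{Z}_p\setminus\mathbb{Z}_p^*}$ equals: $3$ if $|a|_p^3<|b|_p^2<1$, $p\equiv1\ (3)$, $\sqrt[3]{b}$ exists; $3$ if $|a|_p^3=|b|_p^2<1$, $0\le|D|_p<1$, $\sqrt D$ exists; $3$ if $|a|_p^3=|b|_p^2<1$, $|D|_p=1$, $D_0u_{p-2}^2\equiv0\ (p)$; $3$ if $|b|_p^2<|a|_p^3<1$, $\sqrt{-a}$ exists; $1$ if $|a|_p^3<|b|_p^2<1$, $p\equiv2\ (3)$,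 $\sqrt[3]{b}$ exists; $1$ if $|a|_p^3=|b|_p^2<1$, $0<|D|_p<1$, $\sqrt D$ does not exist; $1$ if $|a|_p^3=|b|_p^2<1$, $|D|_p=1$, $D_0u_{p-2}^2\not\equiv0,9a_0^2\ (p)$; $1$ if $|b|_p^2<|a|_p^3<1$, $\sqrt{-a}$ does not exist; $1$ if $|b|_p^2<|a|_p^3$, $|b|_p<|a|_p$, $|a|_p\ge1$. $N_{\mathbb{Q}_p\setminus\mathbb{Z}_p}$ equals: $3$ if $|a|_p^3<|b|_p^2$, $|b|_p>1$, $p\equiv1\ (3)$, $\sqrt[3]{b}$ exists; $3$ if $|a|_p^3=|b|_p^2>1$, $0\le|D|_p<1$, $\sqrt D$ exists; $3$ if $|a|_p^3=|b|_p^2>1$, $|D|_p=1$, $D_0u_{p-2}^2\equiv0\ (p)$; $3$ if $|a|_p^3>|b|_p^2$, $|a|_p<|b|_p$, $\sqrt{-a}$ exists; $2$ if $|a|_p^3>|b|_p^2$, $|a|_p\ge|b|_p$, $|a|_p>1$, $\sqrt{-a}$ exists; $1$ if $|a|_p^3<|b|_p^2$, $|b|_p>1$, $p\equiv2\ (3)$, $\sqrt[3]{b}$ exists; $1$ if $|a|_p^3=|b|_p^2>1$, $0<|D|_p<1$, $\sqrt D$ does not exist; $1$ if $|a|_p^3=|b|_p^2>1$, $|D|_p=1$, $D_0u_{p-2}^2\not\equiv0,9a_0^2\ (p)$; $1$ if $|a|_p^3>|b|_p^2$, $|a|_p<|b|_p$, $\sqrt{-a}$ does not exist. $N_{\mathbb{Q}_p}$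 equals: $3$ if $|a|_p^3<|b|_p^2$, $p\equiv1\ (3)$, $\sqrt[3]{b}$ exists; $3$ if $|a|_p^3=|b|_p^2$, $0\le|D|_p<1$, $\sqrt D$ exists; $3$ if $|a|_p^3=|b|_p^2$, $|D|_p=1$, $D_0u_{p-2}^2\equiv0\ (p)$; $3$ if $|a|_p^3>|b|_p^2$, $\sqrt{-a}$ exists; $1$ if $|a|_p^3<|b|_p^2$, $p\equiv2\ (3)$, $\sqrt[3]{b}$ exists; $1$ if $|a|_p^3=|b|_p^2$, $0<|D|_p<1$, $\sqrt D$ does not exist; $1$ if $|a|_p^3=|b|_p^2$, $|D|_p=1$, $D_0u_{p-2}^2\not\equiv0,9a_0^2\ (p)$; $1$ if $|a|_p^3>|b|_p^2$, $\sqrt{-a}$ does not exist.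
   Context: $\mathbb{Z}_p=\{|x|_p\le1\}$, $\mathbb{Z}_p^*=\{|x|_p=1\}$. Nonzero $c\in\mathbb{Q}_p$ is written $c=c^*/|c|_p$, $c^*=c_0+c_1p+\cdots\in\mathbb{Z}_p^*$, $c_0\in\{1,\dots,p-1\}$. For nonzero $c$: ''$\sqrt{c}$ exists'' means $c_0^{(p-1)/2}\equiv1\pmod p$ and $\log_p|c|_p$ even ($\sqrt0$ is regarded as existing); ''$\sqrt[3]{c}$ exists'' means $c_0^{(p-1)/\gcd(3,p-1)}\equiv1\pmod p$ and $3\mid\log_p|c|_p$. $D_0=-4a_0^3-27b_0^2$; integers $u_n$: $u_1=0,u_2=-a_0,u_3=b_0,u_{n+3}=b_0u_n-a_0u_{n+1}$. $D=-4(a^* )^3-27(b^* )^2$ (equals $-4a^3-27b^2$ when $|a|_p=|b|_p=1$). $\Delta=\Delta_1\cup\Delta_2\cup\Delta_3$ with $\Delta_1=\{|a|_p^3<|b|_p^2,\ \sqrt[3]{b}\text{ exists}\}$, $\Delta_2=\{|a|_p^3=|b|_p^2,\ D_0u_{p-2}^2\not\equiv9a_0^2\pmod p\}$, $\Delta_3=\{|a|_p^3>|b|_p^2\}$. Congruences ''$(p)$'' are mod $p$, ''$(3)$'' mod $3$. *)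

(* Defs.v *)
From HB Require Import structures.
From mathcomp Require Import all_boot all_order all_algebra.
From Stdlib Require Import Classical ClassicalEpsilon FunctionalExtensionality ProofIrrelevance.
Set Implicit Arguments. Unset Strict Implicit. Unset Printing Implicit Defensive.
Import Order.TTheory GRing.Theory Num.Theory.
Local Open Scope ring_scope.

Lemma ZvalD m (hm : (1 < m)%N) (a b : 'Z_m) : val (a + b) = ((val a + val b) %% m)%N.
Proof. rewrite /=. have e := Zp_cast hm. move: (nat_of_ord a) (nat_of_ord b) => x y. by rewrite e. Qed.
Lemma ZvalM m (hm : (1 < m)%N) (a b : 'Z_m) : val (a * b) = ((val a * val b) %% m)%N.
Proof. rewrite /=. have e := Zp_cast hm. move: (nat_of_ord a) (nat_of_ord b) => x y. by rewrite e. Qed.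
Lemma Zval0 m : val (0 : 'Z_m) = 0%N.
Proof. by []. Qed.
Lemma Zval1 m (hm : (1 < m)%N) : val (1 : 'Z_m) = 1%N.
Proof. by rewrite /= modn_small. Qed.
Lemma Zval_lt m (hm : (1 < m)%N) (a : 'Z_m) : (val a < m)%N.
Proof. have e := Zp_cast hm. case: a => /= x. by rewrite e. Qed.
Lemma Zunit m (hm : (1 < m)%N) (a : 'Z_m) : (a \is a GRing.unit) = coprime m (val a).
Proof. by rewrite -unitZpE // natr_Zp. Qed.

Section Padic.
Variable p : nat.

(* the prime actually used: equals p whenever p is prime (as for 'F_p) *)
Definition pprime : nat := pdiv (maxn p 2).
Lemma pprime_prime : prime pprime.
Proof. by apply: pdiv_prime; rewrite leq_max leqnn orbT. Qed.
Lemma pprime_gt1 : (1 < pprime)%N.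
Proof. exact: prime_gt1 pprime_prime. Qed.
Lemma pprimeE : prime p -> pprime = p.
Proof. by move=> pr; rewrite /pprime (maxn_idPl (prime_gt1 pr)) pdiv_id. Qed.

Definition pmod (n : nat) : nat := (pprime ^ n.+1)%N.
Lemma pmod_gt1 n : (1 < pmod n)%N.
Proof.
rewrite /pmod; apply: (leq_trans pprime_gt1).
by rewrite expnS leq_pmulr // expn_gt0 prime_gt0 // pprime_prime.
Qed.
Lemma pmod_dvd n : (pmod n %| pmod n.+1)%N.
Proof. by rewrite /pmod (expnS _ n.+1) dvdn_mull. Qed.

Definition red n (a : 'Z_(pmod n.+1)) : 'Z_(pmod n) := inZp (val a).
Lemma val_red n a : val (@red n a) = (val a %% pmod n)%N.
Proof. rewrite /red /=. have e := Zp_cast (pmod_gt1 n). move: (nat_of_ord a) => x. by rewrite e. Qed.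

Lemma redD n a b : @red n (a + b) = red a + red b.
Proof.
apply: val_inj; rewrite ZvalD ?pmod_gt1 // !val_red ZvalD ?pmod_gt1 //.
by rewrite (modn_dvdm _ (pmod_dvd n)) modnDm.
Qed.
Lemma redM n a b : @red n (a * b) = red a * red b.
Proof.
apply: val_inj; rewrite ZvalM ?pmod_gt1 // !val_red ZvalM ?pmod_gt1 //.
by rewrite (modn_dvdm _ (pmod_dvd n)) modnMm.
Qed.
Lemma red0 n : @red n 0 = 0.
Proof. by apply: val_inj; rewrite val_red /= mod0n. Qed.
Lemma red1 n : @red n 1 = 1.
Proof. by apply: val_inj; rewrite val_red !Zval1 ?pmod_gt1 // modn_small // pmod_gt1. Qed.
Lemma redN n a : @red n (- a) = - red a.
Proof. by apply/eqP; rewrite -addr_eq0 -redD addNr red0. Qed.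
Lemma red_unit n a : (@red n a \is a GRing.unit) = (a \is a GRing.unit).
Proof.
rewrite !Zunit ?pmod_gt1 // val_red coprime_modr /pmod.
by rewrite !coprime_pexpl.
Qed.
Lemma redV n a : @red n a^-1 = (red a)^-1.
Proof.
have [Ua|nUa] := boolP (a \is a GRing.unit); last first.
  by rewrite !invr_out // red_unit.
have Ur : red a \is a GRing.unit by rewrite red_unit.
have h : red a * red a^-1 = 1 by rewrite -redM mulrV // red1.
by rewrite -[LHS]mul1r -(mulVr Ur) -mulrA h mulr1.
Qed.

Definition zcompat (x : forall n, 'Z_(pmod n)) := forall n, red (x n.+1) = x n.

Record padic_int := PadicInt { zseq : forall n, 'Z_(pmod n); zseqP : zcompat zseq }.

Lemma zseq_inj x y : zseq x = zseq y -> x = y.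
Proof.
case: x y => [x hx] [y hy] /= e; subst y.
by rewrite (proof_irrelevance _ hx hy).
Qed.
Lemma zseq_ext x y : (forall n, zseq x n = zseq y n) -> x = y.
Proof. by move=> h; apply: zseq_inj; apply: functional_extensionality_dep. Qed.

Definition padic_int_eqb (x y : padic_int) : bool :=
  if excluded_middle_informative (x = y) then true else false.
Lemma padic_int_eqP : Equality.axiom padic_int_eqb.
Proof.
by move=> x y; rewrite /padic_int_eqb; case: excluded_middle_informative => h;
  constructor.
Qed.
HB.instance Definition _ := hasDecEq.Build padic_int padic_int_eqP.

Definition padic_int_find (P : pred padic_int) (n : nat) : option padic_int :=
  match excluded_middle_informative (exists x, P x) with
  | left H => Some (proj1_sig (constructive_indefinite_description _ H))
  | right _ => None
  end.
Lemma padic_int_find_correct P n x : padic_int_find P n = Some x -> P x.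
Proof.
rewrite /padic_int_find; case: excluded_middle_informative => // H [<-].
exact: proj2_sig (constructive_indefinite_description _ H).
Qed.
Lemma padic_int_find_complete (P : pred padic_int) :
  (exists x, P x) -> exists n, padic_int_find P n.
Proof.
by move=> H; exists 0%N; rewrite /padic_int_find; case: excluded_middle_informative.
Qed.
Lemma padic_int_find_ext (P Q : pred padic_int) :
  P =1 Q -> padic_int_find P =1 padic_int_find Q.
Proof. by move=> /functional_extensionality ->. Qed.
HB.instance Definition _ := hasChoice.Build padic_int
  padic_int_find_correct padic_int_find_complete padic_int_find_ext.

Lemma zcompat0 : zcompat (fun n => 0).
Proof. by move=> n; rewrite red0. Qed.
Lemma zcompat1 : zcompat (fun n => 1).
Proof. by move=> n; rewrite red1. Qed.
Lemma zcompatD x y : zcompat (fun n => zseq x n + zseq y n).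
Proof. by move=> n; rewrite redD !zseqP. Qed.
Lemma zcompatM x y : zcompat (fun n => zseq x n * zseq y n).
Proof. by move=> n; rewrite redM !zseqP. Qed.
Lemma zcompatN x : zcompat (fun n => - zseq x n).
Proof. by move=> n; rewrite redN !zseqP. Qed.
Lemma zcompatV x : zcompat (fun n => (zseq x n)^-1).
Proof. by move=> n; rewrite redV !zseqP. Qed.

Definition zp0 := PadicInt zcompat0.
Definition zp1 := PadicInt zcompat1.
Definition zpadd x y := PadicInt (zcompatD x y).
Definition zpmul x y := PadicInt (zcompatM x y).
Definition zpopp x := PadicInt (zcompatN x).
Definition zpinv x := PadicInt (zcompatV x).

Lemma zpaddA : associative zpadd.
Proof. by move=> x y z; apply: zseq_ext => n /=; rewrite addrA. Qed.
Lemma zpaddC : commutative zpadd.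
Proof. by move=> x y; apply: zseq_ext => n /=; rewrite addrC. Qed.
Lemma zpadd0 : left_id zp0 zpadd.
Proof. by move=> x; apply: zseq_ext => n /=; rewrite add0r. Qed.
Lemma zpaddN : left_inverse zp0 zpopp zpadd.
Proof. by move=> x; apply: zseq_ext => n /=; rewrite addNr. Qed.
HB.instance Definition _ := GRing.isZmodule.Build padic_int
  zpaddA zpaddC zpadd0 zpaddN.

Lemma zpmulA : associative zpmul.
Proof. by move=> x y z; apply: zseq_ext => n /=; rewrite mulrA. Qed.
Lemma zpmulC : commutative zpmul.
Proof. by move=> x y; apply: zseq_ext => n /=; rewrite mulrC. Qed.
Lemma zpmul1 : left_id zp1 zpmul.
Proof. by move=> x; apply: zseq_ext => n /=; rewrite mul1r. Qed.
Lemma zpmulDl : left_distributive zpmul (+%R : padic_int -> _ -> _).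
Proof. by move=> x y z; apply: zseq_ext => n /=; rewrite mulrDl. Qed.
Lemma zp1_neq0 : zp1 != 0.
Proof.
apply/eqP => /(congr1 (fun x => zseq x 0)) /= /(congr1 val).
by rewrite Zval1 ?pmod_gt1.
Qed.
HB.instance Definition _ := GRing.Zmodule_isComNzRing.Build padic_int
  zpmulA zpmulC zpmul1 zpmulDl zp1_neq0.

Lemma zseq_unit (x : padic_int) n :
  (zseq x n \is a GRing.unit) = (zseq x 0 \is a GRing.unit).
Proof. by elim: n => // n IH; rewrite -IH -red_unit zseqP. Qed.

Definition zpunit : {pred padic_int} := fun x => zseq x 0 \is a GRing.unit.
Lemma zpmulV : {in zpunit, left_inverse 1 zpinv *%R}.
Proof.
move=> x Ux; apply: zseq_ext => n /=.
by rewrite mulVr // zseq_unit.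
Qed.
Lemma zpunitPl (x y : padic_int) : y * x = 1 -> zpunit x.
Proof.
move=> /(congr1 (fun z => zseq z 0)) /= h.
by apply/unitrPr; exists (zseq y 0); rewrite mulrC.
Qed.
Lemma zpinv_out : {in [predC zpunit], zpinv =1 id}.
Proof.
move=> x; rewrite inE /= => nU; apply: zseq_ext => n /=.
by rewrite invr_out // zseq_unit.
Qed.
HB.instance Definition _ := GRing.ComNzRing_hasMulInverse.Build padic_int
  zpmulV zpunitPl zpinv_out.


Lemma zval_mod (x : padic_int) k n :
  (k <= n)%N -> (val (zseq x n) %% pmod k)%N = val (zseq x k).
Proof.
elim: n => [|n IH].
  by rewrite leqn0 => /eqP ->; rewrite modn_small // Zval_lt ?pmod_gt1.
rewrite leq_eqVlt => /orP [/eqP ->|]; first by rewrite modn_small // Zval_lt ?pmod_gt1.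
rewrite ltnS => kn.
rewrite -(IH kn) -[in RHS](zseqP x n) val_red modn_dvdm //.
by rewrite /pmod dvdn_exp2l.
Qed.

Lemma zval_nz (x : padic_int) : x != 0 -> exists i, forall n, (i <= n)%N ->
  (pprime ^ i %| val (zseq x n))%N && ~~ (pprime ^ i.+1 %| val (zseq x n))%N.
Proof.
move=> nx.
have ex : exists i, zseq x i != 0.
  case: (classic (exists i, zseq x i != 0)) => // h; exfalso.
  apply/(negP nx)/eqP/zseq_ext => n /=.
  by apply/eqP; apply: contraT => hn; case: h; exists n.
case: (ex_minnP ex) => i hi hmin; exists i => n le.
apply/andP; split.
  case: i hi hmin le => [|j] hi hmin le; first by rewrite expn0 dvd1n.
  have xj : zseq x j = 0.
    by apply/eqP; apply: contraT => h; have := hmin _ h; rewrite ltnn.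
  have := zval_mod x (leq_trans (leqnSn j) le); rewrite xj /= => h.
  by rewrite /dvdn; apply/eqP; rewrite -/(pmod j) h.
rewrite -/(pmod i) /dvdn zval_mod //.
Qed.

Lemma zp_integral : GRing.integral_domain_axiom padic_int.
Proof.
move=> x y xy0.
case: (eqVneq x 0) => // nx; case: (eqVneq y 0) => // ny; exfalso.
have [i hi] := zval_nz nx; have [j hj] := zval_nz ny.
have e : zseq x (i + j) * zseq y (i + j) = 0 := congr1 (fun z => zseq z (i + j)) xy0.
move/(congr1 val): e; rewrite ZvalM ?pmod_gt1 // => /eqP h.
have {h}h : (pmod (i + j) %| val (zseq x (i + j)) * val (zseq y (i + j)))%N by [].
case/andP: (hi (i + j)%N (leq_addr _ _)) => /dvdnP [u eu] nu.
case/andP: (hj (i + j)%N (leq_addl _ _)) => /dvdnP [w ew] nw.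
move: h nu nw; rewrite eu ew /pmod => h nu nw.
have pg := prime_gt0 pprime_prime.
have : (pprime %| u * w)%N.
  have e : (u * pprime ^ i * (w * pprime ^ j) = pprime ^ (i + j) * (u * w))%N.
    by rewrite expnD mulnACA mulnC.
  move: h; rewrite e expnSr.
  by rewrite dvdn_pmul2l // expn_gt0 pg.
rewrite Euclid_dvdM ?pprime_prime // => /orP [] hd.
  by move: nu; rewrite expnSr mulnC dvdn_pmul2r ?expn_gt0 ?pg // hd.
by move: nw; rewrite expnSr mulnC dvdn_pmul2r ?expn_gt0 ?pg // hd.
Qed.
HB.instance Definition _ := GRing.ComUnitRing_isIntegral.Build padic_int
  zp_integral.

Definition padic : Type := {fraction padic_int}.
HB.instance Definition _ := GRing.Field.on padic.


(* valuation of a nonzero p-adic integer: number of leading zero residues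
   (= largest k with p^k dividing it); 0 for the zero element *)
Definition zval (z : padic_int) : nat :=
  match excluded_middle_informative (exists i, zseq z i != 0) with
  | left H => ex_minn H
  | right _ => 0%N
  end.

Definition pval (c : padic) : int :=
  (zval (\n_(repr c)))%:Z - (zval (\d_(repr c)))%:Z.

Definition pabs (c : padic) : rat :=
  if c == 0 then 0 else (pprime%:Q) ^ (- pval c).

(* c^* = c * p^(-v(c)) = c * |c|_p, so that c = c^* / |c|_p (a unit of Z_p if c <> 0) *)
Definition punit (c : padic) : padic := c * (pprime%:R) ^ (- pval c).

(* first digit c_0 in {1,...,p-1} of c^* = c_0 + c_1 p + ... *)
Definition pdigit (c : padic) : nat :=
  if [pick k : 'I_pprime | (0 < k)%N && (pabs (punit c - (val k)%:R) < 1)]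
  is Some k then val k else 0%N.

Definition plog (c : padic) : int := - pval c.

Definition sqrt_exists (c : padic) : bool :=
  (c == 0) ||
  ((pdigit c ^ (p.-1 %/ 2) == 1 %[mod p])%N && (2 %| plog c)%Z).

(* "cube root of c exists" (for nonzero c) *)
Definition cbrt_exists (c : padic) : bool :=
  (pdigit c ^ (p.-1 %/ gcdn 3 p.-1) == 1 %[mod p])%N && (3 %| plog c)%Z.

End Padic.

Arguments pabs {p}.
Arguments punit {p}.
Arguments pdigit {p}.
Arguments pval {p}.
Arguments plog {p}.
Arguments sqrt_exists {p}.
Arguments cbrt_exists {p}.

(* integers u_n : u_1 = 0, u_2 = -a0, u_3 = b0, u_(n+3) = b0 u_n - a0 u_(n+1);
   (u_0 = 1 is the value forced by the recursion; it is never used) *)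
Fixpoint useq (a0 b0 : int) (n : nat) : int :=
  match n with
  | 0 => 1
  | 1 => 0
  | 2 => - a0
  | S (S ((S m) as k)) => b0 * useq a0 b0 m - a0 * useq a0 b0 k
  end.

Definition D0 (a0 b0 : int) : int := - 4 * a0 ^+ 3 - 27 * b0 ^+ 2.

Definition Dstar p (a b : padic p) : padic p :=
  - 4 * (punit a) ^+ 3 - 27 * (punit b) ^+ 2.

Definition nroots (F : fieldType) (f : {poly F}) (A : pred F) (N : nat) : Prop :=
  exists rs : seq F,
    [/\ uniq rs, (forall x, x \in rs <-> (root f x /\ A x))
      & N = (\sum_(r <- rs) mup r f)%N].

Definition cubic (F : fieldType) (a b : F) : {poly F} := 'X^3 + a *: 'X - b%:P.

Definition inDelta p (a b : padic p) : bool :=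
  let a0 := (pdigit a)%:Z in let b0 := (pdigit b)%:Z in
  [|| (pabs a ^+ 3 < pabs b ^+ 2) && cbrt_exists b,
      (pabs a ^+ 3 == pabs b ^+ 2) &&
        (D0 a0 b0 * useq a0 b0 (p - 2) ^+ 2 != 9 * a0 ^+ 2 %[mod p])%Z
    | pabs b ^+ 2 < pabs a ^+ 3].

(* Main.v *)
From HB Require Import structures.
From mathcomp Require Import all_boot all_order all_algebra.
From mathcomp Require Import all_fingroup all_solvable all_field.
From mathcomp Require Import ring generic_quotient.
From Stdlib Require Import Classical ClassicalEpsilon.
Require Import Defs.
Set Implicit Arguments. Unset Strict Implicit. Unset Printing Implicit Defensive.
Import Order.TTheory GRing.Theory Num.Theory.
Local Open Scope ring_scope.

(** Once one root [r] of f = X^3 + a X - b is known, the other two lie in Q_p exactly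
    when -3 r^2 - 4 a is a square, and D(f) = (-3 r^2 - 4 a) f'(r)^2.  The root [r]
    always comes from Hensel's lemma after rescaling:
    - |a|^3 < |b|^2: lift a cube root of the leading digit of [b]; the remaining
      discriminant is -3 times a square up to a 1-unit, hence a square iff p = 1 mod 3;
    - |a|^3 = |b|^2 and |D| < 1: lift the simple root -3 b / a of the cubic mod p;
    - |a|^3 = |b|^2 and |D| = 1: lift a root mod p; the cycle type of Frobenius on the
      roots of the reduction is read off from D_0 u_{p-2}^2;
    - |a|^3 > |b|^2: lift the root 1 of c Y^3 + Y = 1, where c = b^2 / a^3 and
      x = (b / a) y; the remaining discriminant is -4 a up to a 1-unit.
    The absolute values of the roots follow from the ultrametric inequality. *)

(** * Cubic polynomials over a field *)

(** A root-free factor [g] is allowed so that one count serves both a split cubic ([g] = 1) and a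
    cubic with a single root ([g] a quadratic without roots). Repetitions in [rs] account for
    multiplicities. *)
Lemma nroots_prod_XsubC (F : fieldType) (rs : seq F) (g : {poly F}) (A : pred F) :
  g != 0 -> (forall x, ~~ root g x) ->
  nroots (\prod_(r <- rs) ('X - r%:P) * g) A (count A rs).
Proof.
move=> g0 gr; exists (undup (filter A rs)); split; first exact: undup_uniq.
  move=> x; rewrite mem_undup mem_filter rootM root_prod_XsubC (negbTE (gr x)) orbF.
  by split=> [/andP[]|[-> ->]].
have h r : mup r (\prod_(r <- rs) ('X - r%:P) * g) = count_mem r rs.
  by rewrite mupMl // mu_prod_XsubC.
under eq_bigr do rewrite h.
rewrite -size_filter -sum1_size.
(* Regrouping the filtered list by distinct values weights each root by its number of
   occurrences. *)
rewrite -big_undup_iterop_count big_seq [RHS]big_seq.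
apply: eq_bigr => r; rewrite mem_undup mem_filter => /andP[Ar _].
rewrite Monoid.iteropE iter_addn mul1n addn0 count_filter.
by apply: eq_count => s /=; case: eqVneq => // ->.
Qed.

Section CubicFactor.
Variables (F : fieldType) (a b r : F).
Hypotheses (two_neq0 : 2 != 0 :> F) (root_r : r ^+ 3 + a * r = b).

(** The cofactor X^2 + r X + (r^2 + a) has discriminant -3 r^2 - 4 a, so the quadratic formula gives
    its roots; coinciding entries of the list are multiple roots. *)
Lemma nroots_cubic3 (d : F) (A : pred F) : - 3 * r ^+ 2 - 4 * a = d ^+ 2 ->
  nroots (cubic a b) A (count A [:: r; (d - r) / 2; (- d - r) / 2]).
Proof.
move=> hd.
have -> : cubic a b =
    \prod_(z <- [:: r; (d - r) / 2; (- d - r) / 2]) ('X - z%:P) * 1.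
  set s := (d - r) / 2; set t := (- d - r) / 2.
  have st : s + t = - r by rewrite /s /t; field.
  have ht : t = - r - s by rewrite -st; ring.
  have qe : a = - r ^+ 2 + s * t.
    have e : 4 * a = - 3 * r ^+ 2 - d ^+ 2 by rewrite -hd; ring.
    have four : 4 = 2 * 2 :> F by ring.
    apply: (mulfI (mulf_neq0 two_neq0 two_neq0)).
    by rewrite -four e /s /t; field.
  rewrite !big_cons big_nil /cubic -root_r qe ht -mul_polyC.
  rewrite !(rmorphD, rmorphN, rmorphM, rmorphXn) /=; ring.
by apply: nroots_prod_XsubC => [|x]; rewrite ?oner_neq0 // root1.
Qed.

Lemma nroots_cubic1 (A : pred F) : ~ (exists d, - 3 * r ^+ 2 - 4 * a = d ^+ 2) ->
  nroots (cubic a b) A (count A [:: r]).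
Proof.
move=> nd.
have -> : cubic a b =
    \prod_(z <- [:: r]) ('X - z%:P) * ('X ^+ 2 + r%:P * 'X + (r ^+ 2 + a)%:P).
  rewrite big_seq1 /cubic -root_r -mul_polyC.
  rewrite !(rmorphD, rmorphN, rmorphM, rmorphXn) /=; ring.
have h x : ~~ root ('X ^+ 2 + r%:P * 'X + (r ^+ 2 + a)%:P) x.
  apply/negP => /rootP; rewrite !hornerE => e.
  (* At a root [x] of the monic cofactor, its derivative 2 x + r is a square root of its
     discriminant. *)
  apply: nd; exists (2 * x + r).
  have -> : a = - (x ^+ 2 + r * x) - r ^+ 2.
    apply/eqP; rewrite -subr_eq0 -[X in _ == X](e : x ^+ 2 + r * x + r ^+ 2 + a = 0).
    by apply/eqP; ring.
  ring.
apply: nroots_prod_XsubC => //.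
by apply: contraNneq (h 0) => ->; rewrite root0.
Qed.

Lemma quadratic_formula_root (d : F) : - 3 * r ^+ 2 - 4 * a = d ^+ 2 ->
  ((d - r) / 2) ^+ 2 + r * ((d - r) / 2) + (r ^+ 2 + a) = 0.
Proof.
move=> hd.
have -> : ((d - r) / 2) ^+ 2 + r * ((d - r) / 2) + (r ^+ 2 + a) =
  (d ^+ 2 - (- 3 * r ^+ 2 - 4 * a)) / 4.
  have four : 4 = 2 * 2 :> F by ring.
  by rewrite four; field; rewrite four mulf_neq0.
by rewrite hd subrr mul0r.
Qed.

End CubicFactor.

(** The factor 3 r^2 + a is the derivative at [r]. Over a field, a repeated root thus forces D = 0,
    and at a simple root D and -3 r^2 - 4 a have the same square class. *)
Lemma cubic_discriminant (R : comNzRingType) (a b r : R) : r ^+ 3 + a * r = b ->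
  - 4 * a ^+ 3 - 27 * b ^+ 2 = (- 3 * r ^+ 2 - 4 * a) * (3 * r ^+ 2 + a) ^+ 2.
Proof. by move=> <-; ring. Qed.

Lemma useqSSS a b n : useq a b n.+3 = b * useq a b n - a * useq a b n.+1.
Proof. by []. Qed.

(* [useq] is the sequence of x^2-coefficients of x^(n+2) reduced modulo the cubic. *)
Lemma expr_useq (R : comNzRingType) (a b : int) (x : R) n :
  x ^+ 3 + a%:~R * x = b%:~R ->
  x ^+ n.+2 = (useq a b n)%:~R * x ^+ 2 + (useq a b n.+1)%:~R * x
              + ((useq a b n.+2)%:~R + a%:~R * (useq a b n)%:~R).
Proof.
move=> hx; elim: n => [|n IH]; first by rewrite /= !rmorphN /=; ring.
rewrite exprS IH useqSSS rmorphB !rmorphM /= -hx; ring.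
Qed.

(** * Finite fields *)

(** The unit group is cyclic, of order m say. If x = g^i for a generator g, the hypothesis says that
    d = gcd(n, m) divides i, and Bezout then solves k n = i modulo m. *)
Lemma finField_nth_power (F : finFieldType) (n : nat) (x : F) : (0 < n)%N ->
  x != 0 -> x ^+ (#|F|.-1 %/ gcdn n #|F|.-1) = 1 -> exists y, y ^+ n = x.
Proof.
move=> n_gt0 x0; set m := #|F|.-1; set d := gcdn n m => hx.
have cardU : #|[set: {unit F}]| = m by rewrite card_finField_unit.
have m_gt0 : (0 < m)%N by rewrite -cardU cardG_gt0.
have [g hg] := cyclicP (field_unit_group_cyclic [set: {unit F}]%G).
have og : #[g]%g = m by rewrite -cardU hg.
have xu : x \is a GRing.unit by rewrite unitfE.
pose u := FinRing.unit F xu.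
have : u \in <[g]>%g by rewrite -hg inE.
case/cycleP => i ui.
have vx : FinRing.uval g ^+ i = x.
  by rewrite -FinRing.val_unitX -ui.
have d_gt0 : (0 < d)%N by rewrite gcdn_gt0 n_gt0.
have dm : (d %| m)%N by apply: dvdn_gcdr.
have di : (d %| i)%N.
  have : (g ^+ (i * (m %/ d)))%g = 1%g.
    by apply: val_inj; rewrite /= FinRing.val_unitX exprM vx hx.
  move/eqP; rewrite -order_dvdn og => h.
  have md : (0 < m %/ d)%N by rewrite divn_gt0 // dvdn_leq.
  by rewrite -(@dvdn_pmul2r _ d i md) mulnC divnK.
have [k _ hk] : exists2 k, True & (i = k * n %[mod m])%N.
  case/dvdnP: di => j ->.
  have [km kn e _] := egcdnP m n_gt0.
  exists (km * j)%N => //; rewrite mulnAC e mulnDl.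
  by rewrite mulnAC modnMDl mulnC -/d.
exists (FinRing.uval g ^+ k); rewrite -exprM -vx -!FinRing.val_unitX.
congr FinRing.uval; apply/eqP; rewrite eq_expg_mod_order og.
by apply/eqP.
Qed.

(** Converse of [finField_nth_power]: together they give Euler's criterion in the form used by
    [sqrt_exists] and [cbrt_exists]. *)
Lemma finField_exp_gcd (F : finFieldType) (n : nat) (x y : F) : (0 < n)%N ->
  y != 0 -> y ^+ n = x -> x ^+ (#|F|.-1 %/ gcdn n #|F|.-1) = 1.
Proof.
move=> n_gt0 y0 <-; rewrite -exprM.
have dn := dvdn_gcdl n #|F|.-1; have dm := dvdn_gcdr n #|F|.-1.
rewrite -{1}(divnK dn) -mulnA [(gcdn _ _ * _)%N]mulnC (divnK dm) mulnC exprM.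
suff -> : y ^+ #|F|.-1 = 1 by rewrite expr1n.
by apply: (mulfI y0); rewrite -exprS prednK ?expf_card ?mulr1 // ltnW // finRing_gt1.
Qed.

Lemma Fp_natr_neq0 (q n : nat) : prime q -> (0 < n < q)%N -> n%:R != 0 :> 'F_q.
Proof.
move=> qp /andP[n0 nq]; rewrite -(dvdn_pcharf (pchar_Fp qp)).
by apply/negP => /(dvdn_leq n0); rewrite leqNgt nq.
Qed.

(** Square roots s of -3 correspond to primitive cube roots of unity w through s = 2 w + 1, and such
    w exist exactly when 3 divides q - 1. *)
Lemma Fp_neg3_square (q : nat) : prime q -> (3 < q)%N ->
  (exists s : 'F_q, s ^+ 2 = - 3) <-> (q %% 3 = 1)%N.
Proof.
move=> qp q3.
have two0 : 2 != 0 :> 'F_q by apply: Fp_natr_neq0 => //; rewrite /= ltnW.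
have three0 : 3 != 0 :> 'F_q by apply: Fp_natr_neq0.
have fq (x : 'F_q) : x ^+ q = x by rewrite -{2}(expf_card x) card_Fp.
split=> [[s hs]|q1].
  pose w : 'F_q := (s - 1) / 2.
  have hw : w ^+ 2 + w + 1 = 0.
    have -> : w ^+ 2 + w + 1 = (s ^+ 2 + 3) / (2 * 2).
      by rewrite /w; field; rewrite (_ : 4 = 2 * 2) ?mulf_neq0 //; ring.
    by rewrite hs addNr mul0r.
  have w3 : w ^+ 3 = 1.
    apply/eqP; rewrite -subr_eq0; apply/eqP.
    by rewrite -(mulr0 (w - 1)) -hw; ring.
  have : (q %% 3 < 3)%N by rewrite ltn_mod.
  case e : (q %% 3)%N => [|[|[|//]]] // _.
    have : (3 %| q)%N by apply/eqP.
    by rewrite dvdn_prime2 // => /eqP e3; rewrite -e3 in q3.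
  (* If q = 2 modulo 3, then w = w^q = w^2, so w = 1 and w^2 + w + 1 = 3 would vanish. *)
  have := congr1 (GRing.exp w) (divn_eq q 3).
  rewrite fq e exprD mulnC exprM w3 expr1n mul1r => w2.
  have w0 : w != 0.
    by apply/eqP => w0; move/eqP: hw; rewrite w0 expr0n !add0r oner_eq0.
  have w1 : w = 1 by apply: (mulfI w0); rewrite mulr1 -expr2 -w2.
  by case/eqP: three0; rewrite -hw w1; ring.
set k := (q %/ 3)%N.
have qk : (q.-1 = k * 3)%N by rewrite {1}(divn_eq q 3) q1 addn1.
have k_gt0 : (0 < k)%N by rewrite divn_gt0 // ltnW.
(* Otherwise X^k - 1 would have all q - 1 = 3 k nonzero elements as roots. The power x^k is then a
   cube root of unity other than 1. *)
have [x x0 xk] : exists2 x : 'F_q, x != 0 & x ^+ k != 1.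
  apply: NNPP => h.
  have /(max_unity_roots k_gt0) : all k.-unity_root (enum (predC1 (0 : 'F_q))).
    apply/allP => x; rewrite mem_enum inE => x0.
    rewrite unity_rootE; apply: contraT => xk; case: h; exists x => //.
  rewrite enum_uniq -cardE cardC1 card_Fp // qk => /(_ isT).
  by rewrite leqNgt ltn_Pmulr.
have : (x ^+ k) ^+ 3 = 1.
  rewrite -exprM -qk; apply: (mulfI x0).
  by rewrite -exprS prednK ?prime_gt0 // fq mulr1.
move: (x ^+ k) xk => w w1 w3.
exists (2 * w + 1); apply/eqP; rewrite -subr_eq0; apply/eqP.
have w10 : w - 1 != 0 by rewrite subr_eq0.
apply: (mulfI w10); rewrite mulr0.
have -> : (w - 1) * ((2 * w + 1) ^+ 2 - -3) = 4 * (w ^+ 3 - 1) by ring.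
by rewrite w3 subrr mulr0.
Qed.

(** * Frobenius acting on the roots of a cubic over F_q *)

Section CubicFrobenius.
Variables (q : nat) (a b : int) (A B : 'F_q).
Hypotheses (aA : a%:~R = A) (bB : b%:~R = B).
Hypotheses (q_prime : prime q) (q_gt3 : (3 < q)%N).
Let D : 'F_q := - 4 * A ^+ 3 - 27 * B ^+ 2.
Let U : 'F_q := (useq a b (q - 2))%:~R.
Hypotheses (b_neq0 : B != 0) (D_neq0 : D != 0).

(* The three alternatives are the cycle types of Frobenius on the roots [x, y, z] of
   the cubic in an algebraic closure; Lagrange interpolation of the map t |-> t^q
   expresses [U] through V = (x - y)(y - z)(z - x), where V^2 = D. *)
Lemma cubic_Fp_cases :
  [\/ [/\ U = 0, exists r, r ^+ 3 + A * r = B & exists s, s ^+ 2 = D],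
      [/\ U != 0, exists r, r ^+ 3 + A * r = B & ~ exists s, s ^+ 2 = D]
    | D * U ^+ 2 = 9 * A ^+ 2].
Proof.
have [L [phi _]] := countable_algebraic_closure 'F_q.
have chL : q \in [pchar L] by rewrite (fmorph_pchar phi) pchar_Fp.
(* X^q - X already splits over F_q, so every element of [L] fixed by Frobenius comes from F_q. *)
have fixF (t : L) : t ^+ q = t -> exists s, phi s = t.
  move=> ht; have := congr1 (map_poly phi) (finField_genPoly 'F_q).
  rewrite card_Fp // rmorphB /= map_polyXn map_polyX rmorph_prod /=.
  under eq_bigr do rewrite rmorphB /= map_polyX map_polyC /=.
  move/(congr1 (horner^~ t)); rewrite !hornerE ht subrr horner_prod.
  move/esym/eqP/prodf_eq0 => [s _]; rewrite !hornerE subr_eq0 => /eqP ->.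
  by exists s.
have fixV s : (phi s) ^+ q = phi s.
  by rewrite -rmorphXn -{2}(expf_card s) card_Fp.
have natL n : (0 < n < q)%N -> n%:R != 0 :> L.
  by rewrite -(rmorph_nat phi) fmorph_eq0; apply: Fp_natr_neq0.
have two0 : 2 != 0 :> L by apply: natL; rewrite /= ltnW.
have four0 : 4 != 0 :> L.
  by rewrite (_ : 4 = 2 * 2); [apply: mulf_neq0 | ring].
have three0 : 3 != 0 :> L by apply: natL.
(* A root [x], then a square root [d] of the discriminant of the cofactor, give all three roots;
   only the Vieta relations are kept. *)
have [x [y [z [e1 e2 e3]]]] : exists x y z : L, [/\ z = - x - y,
    a%:~R = x * y + y * z + z * x & b%:~R = x * y * z].
  have [//|x] := solve_monicpoly (fun i => [:: b%:~R; - a%:~R; 0 : L]`_i) (n := 3).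
  rewrite !big_ord_recl big_ord0 /= => hx.
  have [//|d] := solve_monicpoly
    (fun i => [:: - 3 * x ^+ 2 - 4 * a%:~R; 0 : L]`_i) (n := 2).
  rewrite !big_ord_recl big_ord0 /= => hd.
  have hb : b%:~R = x ^+ 3 + a%:~R * x by rewrite hx /bump /=; ring.
  have ha : a%:~R = (- 3 * x ^+ 2 - d ^+ 2) / (2 * 2) :> L.
    by rewrite hd; field; rewrite ?four0 ?two0.
  exists x, ((d - x) / 2), ((- d - x) / 2); split; first by field.
    by rewrite ha; field; rewrite ?four0 ?two0.
  by rewrite hb ha; field; rewrite ?four0 ?two0.
pose V := (x - y) * (y - z) * (z - x).
have phiA : phi A = a%:~R by rewrite -aA rmorph_int.
have phiB : phi B = b%:~R by rewrite -bB rmorph_int.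
have VD : V ^+ 2 = phi D.
  rewrite /D !(rmorphB, rmorphXn, rmorphM, rmorphN, rmorph_nat) phiA phiB.
  by rewrite /V e2 e3 e1; ring.
have V0 : V != 0 by rewrite -sqrf_eq0 VD fmorph_eq0.
have rootF t : t \in [:: x; y; z] -> t ^+ 3 + a%:~R * t = b%:~R.
  by rewrite !inE => /or3P[] /eqP ->; rewrite e2 e3 e1; ring.
have permF t : t \in [:: x; y; z] -> t ^+ q \in [:: x; y; z].
  move=> /rootF /(congr1 (pFrobenius_aut chL)).
  rewrite !(rmorphD, rmorphXn, rmorphM, rmorph_int) /= pFrobenius_autE => ht.
  rewrite !inE -!(subr_eq0 (t ^+ q)) -!mulf_eq0; apply/eqP.
  by rewrite -(subrr (b%:~R : L)) -{1}ht e2 e3 e1; ring.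
have inF t : t \in [:: x; y; z] -> t ^+ q = t -> exists r, r ^+ 3 + A * r = B.
  move=> /rootF ht /fixF[s hs]; exists s; apply: (fmorph_inj phi).
  by rewrite !(rmorphD, rmorphXn, rmorphM) phiA phiB hs.
have [mx my mz] : [/\ x \in [:: x; y; z], y \in [:: x; y; z] & z \in [:: x; y; z]].
  by rewrite !inE !eqxx !orbT.
(* By [expr_useq] with n = q - 2, a quadratic with leading coefficient [U] takes the value t^q at
   each root t; the right side is V times that coefficient as given by Lagrange interpolation. *)
have hU : phi U * V = - (x ^+ q * (y - z) + y ^+ q * (z - x) + z ^+ q * (x - y)).
  have -> : phi U = (useq a b (q - 2))%:~R by rewrite rmorph_int.
  have exprq t : t \in [:: x; y; z] ->
      t ^+ q = (useq a b (q - 2))%:~R * t ^+ 2 + (useq a b (q - 2).+1)%:~R * t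
               + ((useq a b (q - 2).+2)%:~R + a%:~R * (useq a b (q - 2))%:~R).
    move=> /rootF /(expr_useq (q - 2)) <-.
    by rewrite -(addn2 (q - 2)) subnK // prime_gt1.
  rewrite (exprq x) // (exprq y) // (exprq z) // /V.
  move: (useq _ _ _)%:~R (useq _ _ _)%:~R (useq _ _ _)%:~R => u v w.
  ring.
have hVq : V ^+ q = (x ^+ q - y ^+ q) * (y ^+ q - z ^+ q) * (z ^+ q - x ^+ q).
  by rewrite -(pFrobenius_autE chL) /V !(rmorphM, rmorphB) /= !pFrobenius_autE.
have Vq0 : V ^+ q != 0 by rewrite expf_neq0.
have b0 : b%:~R != 0 :> L by rewrite -phiB fmorph_eq0.
(* V is a square root of D. Frobenius fixes V here, so V lies in F_q and D is a square there; in
   [split1] it negates V, and D is not a square. *)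
have split3 : phi U * V = 0 -> V ^+ q = V -> forall t, t \in [:: x; y; z] ->
    t ^+ q = t -> [/\ U = 0, exists r, r ^+ 3 + A * r = B & exists s, s ^+ 2 = D].
  move=> UV0 VqV t mt tq; split; last 2 first.
  - exact: inF tq.
  - have [s hs] := fixF _ VqV; exists s; apply: (fmorph_inj phi).
    by rewrite rmorphXn hs.
  apply/eqP; rewrite -(fmorph_eq0 phi).
  by move/eqP: UV0; rewrite mulf_eq0 (negbTE V0) orbF.
have split1 : phi U * V != 0 -> V ^+ q = - V -> forall t, t \in [:: x; y; z] ->
    t ^+ q = t -> [/\ U != 0, exists r, r ^+ 3 + A * r = B & ~ exists s, s ^+ 2 = D].
  move=> UV0 VqV t mt tq; split; last 2 first.
  - exact: inF tq.
  - case=> s hs.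
    have : V ^+ 2 == phi s ^+ 2 by rewrite VD -hs rmorphXn.
    have V2 : V = - V -> False.
      move=> h; have : 2 * V == 0 by rewrite mulr2n mulrDl mul1r {2}h subrr.
      by rewrite mulf_eq0 (negbTE two0) (negbTE V0).
    rewrite eqf_sqr => /orP[] /eqP e; apply: V2; rewrite -{1}VqV e ?fixV //.
    by rewrite -(rmorphN phi) fixV.
  by rewrite -(fmorph_eq0 phi); apply: contraNneq UV0 => ->; rewrite mul0r.
have nz3 t : t \in [:: x; y; z] -> t != 0.
  by move=> /rootF h; apply: contraNneq b0 => t0; rewrite -h t0; apply/eqP; ring.
have [x0 y0 z0] := And3 (nz3 _ mx) (nz3 _ my) (nz3 _ mz).
move: (V0); rewrite /V !mulf_eq0 !negb_or => /andP[/andP[xy yz] zx].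
move: (permF _ mx) (permF _ my) (permF _ mz); rewrite !inE.
(* Of the 27 possible images of (x, y, z), those with a repetition contradict [Vq0]; the six
   permutations remain. *)
move=> /or3P[] /eqP ex /or3P[] /eqP ey /or3P[] /eqP ez;
  move: hU hVq; rewrite ex ey ez => hU hVq;
  try (by case/eqP: Vq0; rewrite hVq; ring).
- apply: Or31; apply: (split3 _ _ x mx ex).
    by rewrite hU; ring.
  by rewrite hVq.
(* Transposition fixing [x]: the right side of [hU] becomes -3 x (y - z), nonzero because B != 0
   excludes a zero root. *)
- apply: Or32; apply: (split1 _ _ x mx ex).
    rewrite hU (_ : - _ = - (3 * x * (y - z))); last by rewrite e1; ring.
    by rewrite oppr_eq0 !mulf_neq0.
  by rewrite hVq /V; ring.
- apply: Or32; apply: (split1 _ _ z mz ez).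
    rewrite hU (_ : - _ = - (3 * z * (x - y))); last by rewrite e1; ring.
    by rewrite oppr_eq0 !mulf_neq0.
  by rewrite hVq /V; ring.
(* For a 3-cycle, U V is 3 a or -3 a, and squaring gives the claim. *)
- apply: Or33; apply: (fmorph_inj phi).
  rewrite !(rmorphXn, rmorphM, rmorph_nat) -VD -exprMn mulrC hU phiA e2 e1; ring.
- apply: Or33; apply: (fmorph_inj phi).
  rewrite !(rmorphXn, rmorphM, rmorph_nat) -VD -exprMn mulrC hU phiA e2 e1; ring.
- apply: Or32; apply: (split1 _ _ y my ey).
    rewrite hU (_ : - _ = - (3 * y * (z - x))); last by rewrite e1; ring.
    by rewrite oppr_eq0 !mulf_neq0.
  by rewrite hVq /V; ring.
Qed.
End CubicFrobenius.

(** * p-adic numbers *)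

Section PadicTheory.
Variable p : nat.
Local Notation q := (pprime p).
Local Notation Zp := (padic_int p).
Local Notation Qp := (padic p).
Local Notation "x %:F" := (@FracField.tofrac (padic_int p) x : padic p).

(** A named projection, so that it can carry a ring morphism structure. Level [n] is reduction
    modulo p^(n+1), hence level 0 is reduction modulo p. *)
Definition zlevel n (x : Zp) : 'Z_(pmod p n) := zseq x n.

Fact zlevel_is_zmod_morphism n : zmod_morphism (@zlevel n).
Proof. by []. Qed.
Fact zlevel_is_monoid_morphism n : monoid_morphism (@zlevel n).
Proof. by []. Qed.
HB.instance Definition _ n :=
  GRing.isZmodMorphism.Build _ _ (@zlevel n) (zlevel_is_zmod_morphism n).
HB.instance Definition _ n :=
  GRing.isMonoidMorphism.Build _ _ (@zlevel n) (zlevel_is_monoid_morphism n).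

Lemma zlevel_eq0 n (x : Zp) : (zlevel n x == 0) = (pmod p n %| val (zseq x n))%N.
Proof.
rewrite /dvdn modn_small ?Zval_lt ?pmod_gt1 //.
Qed.

(** If p^(n+1) divides x, then p^(2n+2) divides x^2, and 2n + 2 >= n + 2. This gain of one level
    drives the Newton iteration in [hensel]. *)
Lemma zlevel_sqr0 n (x : Zp) : zlevel n x = 0 -> zlevel n.+1 (x ^+ 2) = 0.
Proof.
move=> h; have d : (pmod p n %| val (zseq x n.+1))%N.
  by rewrite /dvdn zval_mod //; apply/eqP; move/(congr1 val): h.
apply: val_inj; rewrite [LHS]ZvalM ?pmod_gt1 //; apply/eqP.
apply: dvdn_trans (dvdn_mul d d); rewrite /pmod -expnD dvdn_exp2l //.
by rewrite addSn !ltnS leq_addl.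
Qed.

(** Level 0 transported to the prime field ['F_q], where the results on finite fields apply. *)
Definition residue (x : Zp) : 'F_q := (val (zseq x 0))%:R.

Lemma natr_modFp m n : (m = n %[mod q])%N -> m%:R = n%:R :> 'F_q.
Proof.
have pp := pprime_prime p.
by move=> h; rewrite -(Fp_nat_mod pp m) h Fp_nat_mod.
Qed.

Lemma modn_pmod0 m : (m %% pmod p 0 = m %% q)%N.
Proof. by rewrite /pmod expn1. Qed.

Fact residue_is_nmod_morphism : nmod_morphism residue.
Proof.
split=> [|x y]; first by [].
rewrite /residue -natrD; apply: natr_modFp.
by rewrite (ZvalD (pmod_gt1 p 0)) modn_pmod0 modn_mod.
Qed.
Fact residue_is_monoid_morphism : monoid_morphism residue.
Proof.
split=> [|x y]; first by rewrite /residue (Zval1 (pmod_gt1 p 0)).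
rewrite /residue -natrM; apply: natr_modFp.
by rewrite (ZvalM (pmod_gt1 p 0)) modn_pmod0 modn_mod.
Qed.
HB.instance Definition _ := GRing.isNmodMorphism.Build _ _ residue residue_is_nmod_morphism.
HB.instance Definition _ :=
  GRing.isMonoidMorphism.Build _ _ residue residue_is_monoid_morphism.

Lemma residue_eq0 (x : Zp) : (residue x == 0) = (zlevel 0 x == 0).
Proof.
rewrite zlevel_eq0 /dvdn modn_pmod0 -/(dvdn _ _).
by rewrite (dvdn_pcharf (pchar_Fp (pprime_prime p))).
Qed.

Lemma zp_unitE (x : Zp) : (x \is a GRing.unit) = (residue x != 0).
Proof.
rewrite residue_eq0 zlevel_eq0 /dvdn modn_pmod0 -/(dvdn _ _).
rewrite -prime_coprime ?pprime_prime // -[LHS]/(zseq x 0 \is a GRing.unit).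
by rewrite Zunit ?pmod_gt1 // /pmod coprime_pexpl.
Qed.

Lemma residue_surj (s : 'F_q) : exists x, residue x = s.
Proof. by exists (val s)%:R; rewrite rmorph_nat natr_Zp. Qed.

Lemma horner_taylor2 (R : comNzRingType) (f : {poly R}) (x h : R) :
  exists c, f.[x + h] = f.[x] + f^`().[x] * h + h ^+ 2 * c.
Proof.
elim/poly_ind: f => [|f k [c IH]]; first by exists 0; rewrite deriv0 !horner0; ring.
exists (c * (x + h) + f^`().[x]).
rewrite derivD derivC addr0 derivM derivX mulr1 !hornerE IH; ring.
Qed.

Lemma hensel (f : {poly Zp}) (x : Zp) :
  residue f.[x] = 0 -> residue f^`().[x] != 0 ->
  exists y, f.[y] = 0 /\ residue y = residue x.
Proof.
move=> fx dfx.
pose step y := y - f.[y] / f^`().[y].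
pose s n := iter n step x.
have residueE g y z : residue y = residue z -> residue g.[y] = residue g.[z].
  by move=> e; rewrite -!horner_map /= e.
have hs n : zlevel n f.[s n] = 0 /\ residue (s n) = residue x.
  elim: n => [|n [IH1 IH2]].
    by split=> //; apply/eqP; rewrite -residue_eq0 fx.
  set y := s n in IH1 IH2 *.
  have duy : f^`().[y] \is a GRing.unit by rewrite zp_unitE (residueE _ _ _ IH2).
  (* The Newton correction cancels the linear term; what remains is a multiple of its square, which
     vanishes one level higher. *)
  have [c hc] := horner_taylor2 f y (- (f.[y] / f^`().[y])).
  have fy0 : residue f.[y] = 0 by rewrite (residueE _ _ _ IH2).
  have -> : s n.+1 = y - f.[y] / f^`().[y] by [].
  split; last by rewrite rmorphB rmorphM /= fy0 mul0r subr0.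
  have z2 : zlevel n.+1 ((f.[y] / f^`().[y]) ^+ 2) = 0.
    by apply: zlevel_sqr0; rewrite rmorphM /= IH1 mul0r.
  rewrite hc mulrN mulrCA mulrV // mulr1 subrr add0r sqrrN.
  by rewrite [LHS]rmorphM [X in X * _]z2 mul0r.
(* Consecutive iterates differ by a multiple of f(s n), which is zero at level [n], so the diagonal
   sequence is coherent and defines the limit. *)
have compat : zcompat (fun n => zlevel n (s n)).
  move=> n; rewrite /zlevel zseqP -/(zlevel n (s n.+1)) -/(zlevel n (s n)).
  by rewrite /s iterS -/(s n) rmorphB rmorphM /= (hs n).1 mul0r subr0.
exists (PadicInt compat); split.
  apply: zseq_ext => n; rewrite -/(zlevel n _) -/(zlevel n _) raddf0 -horner_map /=.
  by rewrite -[RHS](hs n).1 -horner_map.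
by rewrite /residue /=.
Qed.

(** * Polar decomposition: a power of p times a unit *)

Lemma residue_dvd (x : Zp) : residue x = 0 -> exists y, x = q%:R * y.
Proof.
move/eqP; rewrite residue_eq0 => /eqP x0.
have q_gt0 : (0 < q)%N := prime_gt0 (pprime_prime p).
have dv n : (q %| val (zseq x n))%N.
  have := zval_mod x (leq0n n); rewrite [RHS](congr1 val x0) modn_pmod0 => h.
  by apply/eqP.
(* Division by q costs one level: level [n] of the quotient is read off from level [n.+1] of [x]. *)
pose y n : 'Z_(pmod p n) := (val (zseq x n.+1) %/ q)%:R.
have vy n : val (y n) = (val (zseq x n.+1) %/ q)%N.
  rewrite -[LHS]/(nat_of_ord _) val_Zp_nat ?pmod_gt1 // modn_small //.
  by rewrite ltn_divLR // -expnSr Zval_lt ?pmod_gt1.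
have yc : zcompat y.
  move=> n; apply: val_inj; rewrite val_red !vy.
  rewrite -(zval_mod x (leqnSn n.+1)).
  by rewrite /pmod [(q ^ n.+2)%N]expnSr -modn_divl.
exists (PadicInt yc); apply: zseq_ext => n.
have -> : zseq (q%:R * PadicInt yc) n = q%:R * y n.
  by rewrite -/(zlevel n _) rmorphM rmorph_nat.
rewrite /y -natrM mulnC divnK //.
by rewrite -(Zp_nat_mod (pmod_gt1 p n)) zval_mod // natr_Zp.
Qed.

Lemma zp_polar (x : Zp) : x != 0 ->
  exists u, u \is a GRing.unit /\ x = q%:R ^+ (zval x) * u.
Proof.
move=> x0; rewrite /zval.
case: excluded_middle_informative => [H|H]; last first.
  case/eqP: x0; apply: zseq_ext => n; apply/eqP; apply: contraT => h.
  by case: H; exists n.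
case: ex_minnP => i hi hmin.
(* Induction on the valuation for all [x] at once: dividing by q shifts every level down by one
   ([lev]). *)
elim: i x {x0 H} hi hmin => [|i IH] x hi hmin.
  by exists x; rewrite expr0 mul1r zp_unitE residue_eq0.
have [|y xy] := @residue_dvd x.
  by apply/eqP; rewrite residue_eq0; apply: contraT => /hmin.
have q_gt0 : (0 < q)%N := prime_gt0 (pprime_prime p).
have lev n : (zlevel n.+1 x == 0) = (zlevel n y == 0).
  rewrite !zlevel_eq0.
  have -> : (val (zseq x n.+1) = (q * val (zseq y n.+1)) %% pmod p n.+1)%N.
    have -> : zseq x n.+1 = (q * val (zseq y n.+1))%:R.
      by rewrite natrM natr_Zp xy -/(zlevel _ _) rmorphM rmorph_nat.
    by rewrite -[LHS]/(nat_of_ord _) val_Zp_nat ?pmod_gt1.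
  rewrite {1}/dvdn modn_mod -/(dvdn _ _) {1}/pmod expnS dvdn_pmul2l //.
  by rewrite -/(pmod p n) /dvdn zval_mod // modn_small ?Zval_lt ?pmod_gt1.
have [||u [uu hu]] := IH y.
- by rewrite -/(zlevel i y) -lev.
- by move=> n; rewrite -/(zlevel n y) -lev => /hmin.
by exists u; split=> //; rewrite xy hu exprS mulrA.
Qed.

Lemma zp_prime_neq0 : q%:R != 0 :> Zp.
Proof.
have pp := pprime_prime p.
apply/eqP => /(congr1 (zlevel 1)); rewrite rmorph_nat rmorph0 => /(congr1 val).
rewrite -[LHS]/(nat_of_ord _) val_Zp_nat ?pmod_gt1 //= modn_small.
  by move=> q0; move: (prime_gt0 pp); rewrite q0.
by rewrite /pmod -{1}(expn1 q) ltn_exp2l // prime_gt1.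
Qed.

Lemma residue_prime : residue (q%:R : Zp) = 0.
Proof. by rewrite rmorph_nat pchar_Fp_0 // pprime_prime. Qed.

Lemma frac_repr (R : idomainType) (c : {fraction R}) :
  c = FracField.tofrac (\n_(repr c)) / FracField.tofrac (\d_(repr c)).
Proof.
apply: (canRL (mulfK _)); first by rewrite tofrac_eq0 denom_ratioP.
rewrite -{1}[c]reprK; move: (repr c) => x; rewrite !piE.
apply/eqmodP; rewrite /= FracField.equivfE /FracField.mulf.
by rewrite !numden_Ratio ?mulf_neq0 ?oner_neq0 ?denom_ratioP // !mulr1 mulrC.
Qed.

Lemma padic_prime_neq0 : q%:R != 0 :> Qp.
Proof. by rewrite -(rmorph_nat (@FracField.tofrac Zp)) tofrac_eq0 zp_prime_neq0. Qed.

Lemma unit_tofrac_neq0 (u : Zp) : u \is a GRing.unit -> u%:F != 0.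
Proof. by move=> uu; rewrite tofrac_eq0; apply: contraTneq uu => ->; rewrite unitr0. Qed.

Lemma tofracV (u : Zp) : u \is a GRing.unit -> (u^-1)%:F = (u%:F)^-1.
Proof. by move=> uu; rewrite [LHS]rmorphV. Qed.

Lemma padic_polar (c : Qp) : c != 0 ->
  exists u, u \is a GRing.unit /\ c = q%:R ^ (pval c) * u%:F.
Proof.
move=> c0; have hc := frac_repr c; rewrite /pval.
have n0 : \n_(repr c) != 0.
  by apply: contraNneq c0 => n0; rewrite hc n0 rmorph0 mul0r.
have d0 : \d_(repr c) != 0 by rewrite denom_ratioP.
have [u [uu hu]] := zp_polar n0; have [v [vu hv]] := zp_polar d0.
exists (u / v); split; first by rewrite unitrM uu unitrV.
rewrite {1}hc {1}hu {1}hv.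
have q0 := padic_prime_neq0.
rewrite !rmorphM !rmorphXn !rmorph_nat /= (tofracV vu) expfzDr // -exprnN -exprnP.
by rewrite invfM mulrACA.
Qed.

(** After cancelling powers of q, a unit would equal a positive power of q times another unit, whose
    residue is 0. Hence [pval] can be computed from any polar form. *)
Lemma polar_inj (k m : int) (u v : Zp) : u \is a GRing.unit -> v \is a GRing.unit ->
  q%:R ^ k * u%:F = q%:R ^ m * v%:F :> Qp -> k = m.
Proof.
wlog: k m u v / k <= m => [hw uu vu e|km uu vu].
  case/orP: (le_total k m) => km; first exact: hw e.
  by apply/esym; apply: hw (esym e).
have q0 := padic_prime_neq0.
rewrite -(subrK k m) expfzDr // [q%:R ^ (_ - _) * _]mulrC -mulrA.
move/(mulfI (expfz_neq0 _ q0)).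
have [n ->] : exists n : nat, m - k = n by exists `|m - k|%N; rewrite gez0_abs ?subr_ge0.
case: n => [_|n]; first by rewrite add0r.
rewrite -exprnP -(rmorph_nat (@FracField.tofrac Zp)) -rmorphXn -rmorphM => /eqP.
rewrite tofrac_eq => /eqP hu; move: uu; rewrite hu zp_unitE !rmorphM rmorphXn /=.
by rewrite residue_prime expr0n mul0r eqxx.
Qed.

Lemma pval_polar (k : int) (u : Zp) : u \is a GRing.unit ->
  pval (q%:R ^ k * u%:F) = k.
Proof.
move=> uu; have c0 : q%:R ^ k * u%:F != 0.
  by rewrite mulf_neq0 ?expfz_neq0 ?padic_prime_neq0 ?unit_tofrac_neq0.
have [v [vu e]] := padic_polar c0.
by rewrite [RHS](polar_inj uu vu e).
Qed.

(** * The p-adic absolute value *)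

Lemma pabs_eq0 (c : Qp) : (pabs c == 0) = (c == 0).
Proof.
rewrite /pabs; have [_|c0] := eqVneq c 0; first by rewrite eqxx.
apply/negbTE; rewrite expfz_neq0 //.
by rewrite pnatr_eq0 -lt0n prime_gt0 // pprime_prime.
Qed.

Lemma pabs_ge0 (c : Qp) : 0 <= pabs c.
Proof. by rewrite /pabs; case: eqP => // _; rewrite exprz_ge0. Qed.

Lemma pabs_gt0 (c : Qp) : (0 < pabs c) = (c != 0).
Proof. by rewrite lt0r pabs_eq0 pabs_ge0 andbT. Qed.

Lemma pabs0 : pabs (0 : Qp) = 0.
Proof. by rewrite /pabs eqxx. Qed.

Lemma pabs_polar (k : int) (u : Zp) : u \is a GRing.unit ->
  pabs (q%:R ^ k * u%:F) = (q%:Q) ^ (- k).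
Proof.
move=> uu; rewrite /pabs pval_polar // ifN //.
by rewrite mulf_neq0 ?expfz_neq0 ?padic_prime_neq0 ?unit_tofrac_neq0.
Qed.

Lemma pabsM (c d : Qp) : pabs (c * d) = pabs c * pabs d.
Proof.
have [->|c0] := eqVneq c 0; first by rewrite mul0r pabs0 mul0r.
have [->|d0] := eqVneq d 0; first by rewrite mulr0 pabs0 mulr0.
have [u [uu ->]] := padic_polar c0; have [v [vu ->]] := padic_polar d0.
have qQ : q%:Q != 0 by rewrite pnatr_eq0 -lt0n prime_gt0 // pprime_prime.
rewrite mulrACA -expfzDr ?padic_prime_neq0 // -rmorphM !pabs_polar ?unitrM ?uu //.
by rewrite opprD expfzDr.
Qed.

Lemma pabs1 : pabs (1 : Qp) = 1.
Proof. by have := pabs_polar 0 (unitr1 Zp); rewrite rmorph1 mulr1 oppr0. Qed.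

Lemma pabsX (c : Qp) n : pabs (c ^+ n) = pabs c ^+ n.
Proof. by elim: n => [|n IH]; rewrite ?pabs1 // !exprS pabsM IH. Qed.

Lemma pabsV (c : Qp) : pabs c^-1 = (pabs c)^-1.
Proof.
have [->|c0] := eqVneq c 0; first by rewrite invr0 pabs0 invr0.
have a0 : pabs c != 0 by rewrite pabs_eq0.
by apply: (mulfI a0); rewrite -pabsM !mulfV // pabs1.
Qed.

Lemma pabsN (c : Qp) : pabs (- c) = pabs c.
Proof.
have -> : - c = (- 1)%:F * c by rewrite rmorphN rmorph1 mulN1r.
have := @pabs_polar 0 (- 1) _; rewrite unitrN unitr1 expr0z mul1r => h.
by rewrite pabsM h // oppr0 expr0z mul1r.
Qed.

Lemma pabs_unit (u : Zp) : u \is a GRing.unit -> pabs u%:F = 1.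
Proof. by move=> uu; have := pabs_polar 0 uu; rewrite mul1r oppr0. Qed.

(** Bridge from absolute values back to p-adic integers: quotients of size at most 1 become
    coefficients to which [hensel] and [residue] apply. *)
Lemma pabs_le1P (c : Qp) : reflect (exists z : Zp, c = z%:F) (pabs c <= 1).
Proof.
have q1 : 1 < q%:Q by rewrite ltr1n prime_gt1 // pprime_prime.
have [->|c0] := eqVneq c 0.
  by rewrite pabs0 ler01; constructor; exists 0; rewrite rmorph0.
apply: (iffP idP) => [|[z hz]].
  have [u [uu ->]] := padic_polar c0; rewrite pabs_polar //.
  rewrite -(expr0z (q%:Q)) ler_eXz2l // oppr_le0.
  case: (pval c) => // n _; exists (q%:R ^+ n * u).
  by rewrite rmorphM rmorphXn rmorph_nat.
have z0 : z != 0 by rewrite -tofrac_eq0 -hz.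
have [u [uu hu]] := zp_polar z0.
rewrite hz hu rmorphM rmorphXn rmorph_nat exprnP pabs_polar //.
by rewrite -(expr0z (q%:Q)) ler_eXz2l // oppr_le0.
Qed.

Lemma pabs_le1 (z : Zp) : pabs z%:F <= 1.
Proof. by apply/pabs_le1P; exists z. Qed.

Lemma pabs_eq1 (z : Zp) : (pabs z%:F == 1) = (residue z != 0).
Proof.
have q1 : 1 < q%:Q by rewrite ltr1n prime_gt1 // pprime_prime.
apply/eqP/idP => [h|]; last by rewrite -zp_unitE => /pabs_unit.
have z0 : z != 0 by apply: contra_eq_neq h => ->; rewrite rmorph0 pabs0 eq_sym oner_eq0.
have [u [uu hu]] := zp_polar z0; move: h.
rewrite {1}hu rmorphM rmorphXn rmorph_nat exprnP pabs_polar //.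
rewrite -[X in _ = X -> _](expr0z (q%:Q)).
move/(ieexprIz (lt_trans ltr01 q1) (negbT (gt_eqF q1))).
by case: (zval z) hu => [|//]; rewrite expr0 mul1r => -> _; rewrite -zp_unitE.
Qed.

Lemma pabs_lt1 (z : Zp) : (pabs z%:F < 1) = (residue z == 0).
Proof. by rewrite lt_neqAle pabs_le1 andbT pabs_eq1 negbK. Qed.

Lemma pabs_nat1 n : n%:R != 0 :> 'F_q -> pabs (n%:R : Qp) = 1.
Proof.
move=> h; apply/eqP; rewrite -(rmorph_nat (@FracField.tofrac Zp)) pabs_eq1.
by rewrite rmorph_nat.
Qed.

(** Write c + d = (c / d + 1) d: the first factor has residue 1, hence is a unit. *)
Lemma pabsD_lt (c d : Qp) : pabs c < pabs d -> pabs (c + d) = pabs d.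
Proof.
move=> cd; have d0 : d != 0 by rewrite -pabs_gt0 (le_lt_trans (pabs_ge0 c)).
have /pabs_le1P[z hz] : pabs (c / d) <= 1.
  by rewrite pabsM pabsV ltW // ltr_pdivrMr ?pabs_gt0 // mul1r.
have : pabs (c / d) < 1 by rewrite pabsM pabsV ltr_pdivrMr ?pabs_gt0 // mul1r.
rewrite hz pabs_lt1 => /eqP rz.
have -> : c + d = (z + 1)%:F * d by rewrite rmorphD rmorph1 /= -hz mulrDl mul1r divfK.
by rewrite pabsM pabs_unit ?mul1r // zp_unitE rmorphD rmorph1 /= rz add0r oner_neq0.
Qed.

Lemma pabsD_le (c d : Qp) r : pabs c <= r -> pabs d <= r -> pabs (c + d) <= r.
Proof.
wlog cd : c d / pabs c <= pabs d => [hw cr dr|cr dr].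
  case/orP: (le_total (pabs c) (pabs d)) => h; first exact: hw.
  by rewrite addrC; apply: hw.
have [d0|d0] := eqVneq d 0.
  by rewrite d0 addr0.
have /pabs_le1P[z hz] : pabs (c / d) <= 1.
  by rewrite pabsM pabsV ler_pdivrMr ?pabs_gt0 // mul1r.
have -> : c + d = (z + 1)%:F * d by rewrite rmorphD rmorph1 /= -hz mulrDl mul1r divfK.
by rewrite pabsM (le_trans _ dr) // ler_piMl ?pabs_ge0 ?pabs_le1.
Qed.

Lemma pabsD_ltr (c d : Qp) r : pabs c < r -> pabs d < r -> pabs (c + d) < r.
Proof.
move=> cr dr; apply: le_lt_trans (_ : Num.max (pabs c) (pabs d) < r).
  by apply: pabsD_le; rewrite le_max lexx ?orbT.
by rewrite gt_max cr.
Qed.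

(** * Leading digits and n-th roots *)

Lemma eqn_modFp m n : (m == n %[mod q])%N = (m%:R == n%:R :> 'F_q).
Proof. by rewrite -val_eqE /= !val_Fp_nat ?pprime_prime. Qed.

Lemma eqz_modFp (m n : int) : (m == n %[mod q])%Z = (m%:~R == n%:~R :> 'F_q).
Proof.
by rewrite eqz_mod_dvd (dvdz_pcharf (pchar_Fp (pprime_prime p))) rmorphB subr_eq0.
Qed.

Lemma punit_polar (c : Qp) : c != 0 -> exists u : Zp, [/\ u \is a GRing.unit,
  c = q%:R ^ (pval c) * u%:F, punit c = u%:F & (pdigit c)%:R = residue u].
Proof.
move=> c0; have [u [uu hc]] := padic_polar c0; exists u.
have q0 := padic_prime_neq0.
have pu : punit c = u%:F.
  rewrite /punit {1}hc mulrAC -expfzDr // subrr expr0z mul1r //.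
split=> //; rewrite /pdigit pu.
have lt1E k : (pabs (u%:F - k%:R) < 1) = (k%:R == residue u).
  rewrite -(rmorph_nat (@FracField.tofrac Zp)) -rmorphB pabs_lt1 rmorphB rmorph_nat.
  by rewrite subr_eq0 eq_sym.
(* The search in [pdigit] cannot fail: the canonical representative of the nonzero residue of [u]
   passes the test. *)
case: pickP => [k /andP[_]|h]; first by rewrite lt1E => /eqP.
have klt : (val (residue u) < q)%N.
  by have := ltn_ord (residue u); rewrite [X in (_ < X)%N]Fp_cast ?pprime_prime.
have := h (Ordinal klt); rewrite /= lt1E natr_Zp eqxx andbT.
have : residue u != 0 by rewrite -zp_unitE.
by rewrite -val_eqE /= lt0n => ->.
Qed.

Lemma hensel_nth_root n (z : Zp) (s : 'F_q) : (0 < n)%N -> n%:R != 0 :> 'F_q ->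
  s != 0 -> residue z = s ^+ n -> exists w, w ^+ n = z.
Proof.
move=> n_gt0 n0 s0 hz; have [x hx] := residue_surj s.
have [||w [hw _]] := @hensel ('X^n - z%:P) x.
- by rewrite !hornerE rmorphB rmorphXn /= hx hz subrr.
- rewrite derivB derivC subr0 derivXn hornerMn hornerXn rmorphMn rmorphXn /= hx.
  by rewrite -mulr_natr mulf_neq0 // expf_neq0.
by exists w; apply/eqP; move/eqP: hw; rewrite !hornerE subr_eq0.
Qed.

(** A square root of a unit has absolute value 1, so it is integral and can be reduced modulo p;
    this serves to prove that square roots do not exist. *)
Lemma padic_sqrt_unit (u : Zp) (d : Qp) : u \is a GRing.unit -> d ^+ 2 = u%:F ->
  exists w : Zp, d = w%:F /\ w ^+ 2 = u.
Proof.
move=> uu hd; have d1 : pabs d == 1.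
  by rewrite -sqrp_eq1 ?pabs_ge0 // -pabsX hd pabs_unit.
have /pabs_le1P[w hw] : pabs d <= 1 by rewrite (eqP d1).
by exists w; split=> //; apply/eqP; rewrite -tofrac_eq rmorphXn /= -hw hd.
Qed.

Lemma card_residue_field : #|'F_q| = q.
Proof. exact: card_Fp (pprime_prime p). Qed.

End PadicTheory.

Section RootExistence.
Variable p : nat.
Hypotheses (p_prime : prime p) (p_gt3 : (3 < p)%N).
Local Notation q := (pprime p).
Local Notation Zp := (padic_int p).
Local Notation Qp := (padic p).
Local Notation "x %:F" := (@FracField.tofrac (padic_int p) x : padic p).

Lemma pprime_gt3 : (3 < q)%N.
Proof. by rewrite pprimeE. Qed.

Lemma residue_natr_neq0 n : (0 < n < 4)%N -> n%:R != 0 :> 'F_q.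
Proof.
case/andP=> n0 n4; apply: Fp_natr_neq0; first exact: pprime_prime.
by rewrite n0 (leq_trans n4) // pprime_gt3.
Qed.

(** The digit condition is Euler's criterion modulo p, whose square root lifts by Hensel's lemma;
    the parity condition takes care of the power of p. *)
Lemma sqrt_existsP (c : Qp) : sqrt_exists c <-> exists d, c = d ^+ 2.
Proof.
rewrite /sqrt_exists; have [->|c0] := eqVneq c 0.
  by split=> // _; exists 0; rewrite expr0n.
have [u [uu hc _ hdig]] := punit_polar c0.
have two0 : 2 != 0 :> 'F_q by apply: residue_natr_neq0.
have -> : (p.-1 %/ 2 = #|'F_q|.-1 %/ gcdn 2 #|'F_q|.-1)%N.
  rewrite card_residue_field pprimeE //; congr (_ %/ _)%N.
  apply/esym/gcdn_idPl; rewrite dvdn2.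
  have [p2|] := even_prime p_prime; first by move: p_gt3; rewrite p2.
  by case: (p) (prime_gt0 p_prime) => //= n _; rewrite negbK.
have modE m n : (m == n %[mod p])%N = (m == n %[mod q])%N by rewrite pprimeE.
rewrite modE eqn_modFp natrX hdig /plog rpredN /=.
have u0 : residue u != 0 by rewrite -zp_unitE.
split=> [/andP[/eqP]|[d hd]].
  move/(finField_nth_power (isT : 0 < 2)%N u0) => [s hs].
  have s0 : s != 0 by apply: contraNneq u0 => s0; rewrite -hs s0 expr0n.
  have [w hw] := hensel_nth_root (isT : 0 < 2)%N two0 s0 (esym hs).
  case/dvdzP=> j hj; exists (q%:R ^ j * w%:F).
  by rewrite exprMn -rmorphXn hw {1}hc hj exprnP exprz_exp.
have d0 : d != 0 by apply: contraNneq c0 => d0; rewrite hd d0 expr0n.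
have [v [vu hv]] := padic_polar d0.
have e : q%:R ^ (pval c) * u%:F = q%:R ^ (pval d * 2) * (v ^+ 2)%:F.
  by rewrite -hc hd {1}hv exprMn -rmorphXn [(_ ^ _) ^+ 2]exprnP exprz_exp.
have hpv := polar_inj uu (unitrX 2 vu) e.
apply/andP; split; last by apply/dvdzP; exists (pval d).
have v0 : residue v != 0 by rewrite -zp_unitE.
apply/eqP; apply: (finField_exp_gcd (isT : 0 < 2)%N v0).
move: e; rewrite hpv => /(mulfI (expfz_neq0 _ (padic_prime_neq0 p))) /eqP.
by rewrite tofrac_eq => /eqP ->; rewrite rmorphXn.
Qed.

(** The cube root is extracted only modulo p: it is the whole cubic that gets lifted afterwards. *)
Lemma cbrt_exists_root (c : Qp) : c != 0 -> cbrt_exists c ->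
  exists (j : int) (u : Zp) (s : 'F_q),
    [/\ c = q%:R ^ (j * 3) * u%:F, s != 0 & residue u = s ^+ 3].
Proof.
move=> c0; have [u [uu hc _ hdig]] := punit_polar c0.
have u0 : residue u != 0 by rewrite -zp_unitE.
rewrite /cbrt_exists /plog rpredN.
have -> : (p.-1 = #|'F_q|.-1)%N by rewrite card_residue_field pprimeE.
have modE m n : (m == n %[mod p])%N = (m == n %[mod q])%N by rewrite pprimeE.
rewrite modE eqn_modFp natrX hdig => /andP[/eqP h /dvdzP[j hj]].
have [s hs] := finField_nth_power (isT : 0 < 3)%N u0 h.
exists j, u, s; split=> //; first by rewrite -hj.
by apply: contraNneq u0 => s0; rewrite -hs s0 expr0n.
Qed.

End RootExistence.

(** * Roots of the cubic over Q_p *)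

(** With [A] quantified, one list with multiplicities answers the count in every region. *)
Definition all_roots (F : fieldType) (f : {poly F}) (rs : seq F) : Prop :=
  forall A : pred F, nroots f A (count A rs).

Lemma all_roots_nroots (F : fieldType) (f : {poly F}) (rs : seq F) (A : pred F) :
  all_roots f rs -> (forall x, x \in rs -> A x) -> nroots f A (size rs).
Proof.
move=> h hA; have := h A.
by rewrite (_ : count A rs = size rs) //; apply/eqP; rewrite -all_count; apply/allP.
Qed.

Lemma cubic_eq_quotient (F : fieldType) (a b r s : F) : r ^+ 3 + a * r = b ->
  s ^+ 2 + r * s + (r ^+ 2 + a) = 0 -> s ^+ 3 + a * s = b.
Proof.
move=> hr hs; apply/eqP; rewrite -subr_eq0; apply/eqP.
by rewrite -hr -[RHS](mulr0 (s - r)) -hs; ring.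
Qed.

Lemma rmorph_discriminant (R S : comNzRingType) (f : {rmorphism R -> S}) (u v : R) :
  f (- 4 * u ^+ 3 - 27 * v ^+ 2) = - 4 * f u ^+ 3 - 27 * f v ^+ 2.
Proof. by rewrite !(rmorphB, rmorphXn, rmorphM, rmorphN, rmorph_nat). Qed.

Lemma intr_discriminant_test (R : comNzRingType) (m n k : int) (x y : R) :
  m%:~R = x -> n%:~R = y ->
  (D0 m n * k ^+ 2)%:~R = (- 4 * x ^+ 3 - 27 * y ^+ 2) * k%:~R ^+ 2 /\
  (9 * m ^+ 2)%:~R = 9 * x ^+ 2.
Proof.
move=> <- <-; split; last by rewrite rmorphM rmorphXn.
by rewrite rmorphM rmorphXn; congr (_ * _); apply: (rmorph_discriminant intr).
Qed.

(* If the discriminant vanishes, the cubic is (X - s)^2 (X + 2 s) with s = 3 b / (2 a). *)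
Lemma cubic_simple_root (F : fieldType) (a b : F) : a != 0 ->
  - 4 * a ^+ 3 - 27 * b ^+ 2 = 0 ->
  (- 3 * b / a) ^+ 3 + a * (- 3 * b / a) = b /\ 3 * (- 3 * b / a) ^+ 2 + a = - 3 * a.
Proof.
move=> a0 D0; have b2 : 27 * b ^+ 2 = - 4 * a ^+ 3.
  by apply/eqP; rewrite -subr_eq0 -[X in _ == X]oppr0 -D0; apply/eqP; ring.
split.
  have -> : (- 3 * b / a) ^+ 3 + a * (- 3 * b / a) =
    - (27 * b ^+ 2) * b / a ^+ 3 - 3 * b by field.
  by rewrite b2; field.
have -> : 3 * (- 3 * b / a) ^+ 2 + a = (27 * b ^+ 2) / a ^+ 2 + a by field.
by rewrite b2; field.
Qed.

Lemma cubic_small_root (F : fieldType) (a b y : F) : a != 0 ->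
  b ^+ 2 / a ^+ 3 * y ^+ 3 + y = 1 -> (b / a * y) ^+ 3 + a * (b / a * y) = b.
Proof.
move=> a0 hy.
have -> : (b / a * y) ^+ 3 + a * (b / a * y) = b * (b ^+ 2 / a ^+ 3 * y ^+ 3 + y).
  by field.
by rewrite hy mulr1.
Qed.

Lemma quotient_discriminant_small_root (F : fieldType) (a b y : F) : a != 0 ->
  - 3 * (b / a * y) ^+ 2 - 4 * a =
  (2 ^+ 2 + 3 * (b ^+ 2 / a ^+ 3 * y ^+ 2)) * (- a).
Proof. by move=> a0; field. Qed.

(** Meant for the regimes where all roots have the same absolute value, so that only the length of
    the list matters. *)
Definition root_list (F : fieldType) (a b : F) (n : nat) : Prop :=
  exists rs, [/\ size rs = n, all_roots (cubic a b) rs &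
    forall x, x \in rs -> x ^+ 3 + a * x = b].

Section Regimes.
Variable p : nat.
Hypotheses (p_prime : prime p) (p_gt3 : (3 < p)%N).
Local Notation q := (pprime p).
Local Notation Zp := (padic_int p).
Local Notation Qp := (padic p).
Local Notation "x %:F" := (@FracField.tofrac (padic_int p) x : padic p).

(** The leading coefficient [g] is 1 when |a|^3 <= |b|^2, and b^2 / a^3, with residue 0, when |a|^3
    > |b|^2. *)
Lemma hensel_cubic (g z u : Zp) (s : 'F_q) :
  residue g * s ^+ 3 + residue z * s = residue u ->
  3 * residue g * s ^+ 2 + residue z != 0 ->
  exists y, g * y ^+ 3 + z * y = u /\ residue y = s.
Proof.
move=> h1 h2; have [x hx] := residue_surj s.
pose f : {poly Zp} := g *: 'X^3 + z *: 'X - u%:P.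
have fE t : f.[t] = g * t ^+ 3 + z * t - u.
  by rewrite /f hornerD hornerN hornerC hornerD !hornerZ hornerXn hornerX.
have dfE t : f^`().[t] = (g * t ^+ 2) *+ 3 + z.
  rewrite /f derivB derivC subr0 derivD !derivZ derivXn derivX.
  by rewrite hornerD !hornerZ hornerMn hornerXn hornerC mulr1 mulrnAr.
have [||y [hy1 hy2]] := @hensel p f x.
- by rewrite fE !(rmorphB, rmorphD, rmorphXn, rmorphM) /= hx h1 subrr.
- rewrite dfE rmorphD rmorphMn rmorphM rmorphXn /= hx -mulr_natl mulrA; exact: h2.
by exists y; rewrite hy2 hx; split=> //; apply/eqP; rewrite -subr_eq0 -fE hy1.
Qed.

Lemma padic_two_neq0 : 2 != 0 :> Qp.
Proof.
by rewrite -pabs_eq0 (@pabs_nat1 p 2) ?oner_eq0 // (residue_natr_neq0 p_prime p_gt3).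
Qed.

(** Comparing |x|^2 with |a| compares the terms x^3 and a x; a strictly larger term has absolute
    value |b|. In a tie only |b| <= |x|^3 follows. *)
Lemma cubic_root_pabs (a b x : Qp) : a != 0 -> b != 0 -> x ^+ 3 + a * x = b ->
  [\/ pabs b = pabs x * pabs a /\ pabs b ^+ 2 < pabs a ^+ 3,
      pabs x ^+ 3 = pabs b /\ pabs a ^+ 3 < pabs b ^+ 2
    | pabs x ^+ 2 = pabs a /\ pabs b ^+ 2 <= pabs a ^+ 3].
Proof.
move=> a0 b0 hx.
have x_gt0 : 0 < pabs x.
  rewrite pabs_gt0; apply: contraNneq b0 => x0.
  by rewrite -hx x0 expr0n mulr0 addr0.
have a_gt0 : 0 < pabs a by rewrite pabs_gt0.
case: (ltgtP (pabs x ^+ 2) (pabs a)) => h; [apply: Or31 | apply: Or32 | apply: Or33].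
- have e : pabs (x ^+ 3) < pabs (a * x) by rewrite pabsX pabsM exprSr ltr_pM2r.
  have hb : pabs b = pabs x * pabs a by rewrite -hx (pabsD_lt e) pabsM mulrC.
  by split=> //; rewrite hb exprMn [_ ^+ 3]exprS ltr_pM2r ?exprn_gt0.
- have e : pabs (a * x) < pabs (x ^+ 3) by rewrite pabsX pabsM exprSr ltr_pM2r.
  have hb : pabs x ^+ 3 = pabs b by rewrite -hx addrC (pabsD_lt e) pabsX.
  by split=> //; rewrite -hb exprAC ltrXn2r // ltW.
have hb : pabs b <= pabs x ^+ 3.
  rewrite -hx; apply: pabsD_le; first by rewrite pabsX.
  by rewrite pabsM -h -exprSr.
split=> //; rewrite -h exprAC lerXn2r // ?nnegrE ?pabs_ge0 // exprn_ge0 //.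
exact: pabs_ge0.
Qed.

(** If |s|^2 were also below |a|, the term a would strictly dominate all others in a vanishing
    sum. *)
Lemma quadratic_quotient_root_pabs (a r s : Qp) : pabs r ^+ 2 < pabs a ->
  s ^+ 2 + r * s + (r ^+ 2 + a) = 0 -> pabs a <= pabs s ^+ 2.
Proof.
move=> ra hs; rewrite leNgt; apply/negP => sa.
have : pabs a < pabs a; last by rewrite ltxx.
have {1}-> : a = - (s ^+ 2 + (r * s + r ^+ 2)).
  by apply/eqP; rewrite -subr_eq0 -[X in _ == X]hs; apply/eqP; ring.
rewrite pabsN; apply: pabsD_ltr; first by rewrite pabsX.
apply: pabsD_ltr; last by rewrite pabsX.
rewrite pabsM -(@ltr_pXn2r _ 2) ?nnegrE ?mulr_ge0 ?pabs_ge0 // exprMn [pabs a ^+ 2]expr2.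
have a_gt0 : 0 < pabs a by rewrite (le_lt_trans _ ra) // exprn_ge0 // pabs_ge0.
by rewrite ltr_pM // exprn_ge0 // pabs_ge0.
Qed.

Lemma cubic_all_roots3 (a b r d : Qp) : r ^+ 3 + a * r = b ->
  - 3 * r ^+ 2 - 4 * a = d ^+ 2 ->
  exists s t, [/\ all_roots (cubic a b) [:: r; s; t],
    s ^+ 2 + r * s + (r ^+ 2 + a) = 0 & t ^+ 2 + r * t + (r ^+ 2 + a) = 0].
Proof.
move=> hr hd; exists ((d - r) / 2), ((- d - r) / 2); split.
- by move=> A; apply: nroots_cubic3 hd => //; apply: padic_two_neq0.
- exact: quadratic_formula_root padic_two_neq0 _ hd.
- by apply: quadratic_formula_root padic_two_neq0 _ _; rewrite sqrrN.
Qed.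

Lemma cubic_scale (alpha beta c y : Qp) : y ^+ 3 + alpha * y = beta ->
  (c * y) ^+ 3 + (c ^+ 2 * alpha) * (c * y) = c ^+ 3 * beta.
Proof. by move=> <-; ring. Qed.

Lemma square_scale (c e : Qp) : c != 0 ->
  (exists d, c ^+ 2 * e = d ^+ 2) <-> (exists d, e = d ^+ 2).
Proof.
move=> c0; split=> [[d hd]|[d ->]]; last by exists (c * d); rewrite exprMn.
by exists (d / c); rewrite exprMn exprVn -hd mulrC mulKf ?expf_neq0.
Qed.

(** The substitution x = c y multiplies the discriminant of the cofactor by the square c^2, so the
    number of roots can be decided on the rescaled integral equation. *)
Lemma root_list_scale (alpha beta c y : Qp) : c != 0 -> y ^+ 3 + alpha * y = beta ->
  ((exists d, - 3 * y ^+ 2 - 4 * alpha = d ^+ 2) ->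
    root_list (c ^+ 2 * alpha) (c ^+ 3 * beta) 3) /\
  (~ (exists d, - 3 * y ^+ 2 - 4 * alpha = d ^+ 2) ->
    root_list (c ^+ 2 * alpha) (c ^+ 3 * beta) 1).
Proof.
move=> c0 hy; have hr := cubic_scale c hy.
have hd : - 3 * (c * y) ^+ 2 - 4 * (c ^+ 2 * alpha) =
          c ^+ 2 * (- 3 * y ^+ 2 - 4 * alpha) by ring.
split=> hsq.
  have [d] := (square_scale _ c0).2 hsq; rewrite -hd => hd2.
  have [s [t [h1 h2 h3]]] := cubic_all_roots3 hr hd2.
  exists [:: c * y; s; t]; split=> // x; rewrite !inE => /or3P[] /eqP -> //.
    exact: cubic_eq_quotient hr h2.
  exact: cubic_eq_quotient hr h3.
exists [:: c * y]; split=> // [A|x]; last by rewrite inE => /eqP ->.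
apply: (nroots_cubic1 hr).
by rewrite hd => /(square_scale _ c0).
Qed.

(** * The regime |a|^3 < |b|^2 *)

Section SmallLinearCoefficient.
Variables (a b : Qp).
Hypotheses (a0 : a != 0) (b0 : b != 0) (ab : pabs a ^+ 3 < pabs b ^+ 2).

Lemma root_list_small : cbrt_exists b ->
  root_list a b (if (p %% 3 == 1)%N then 3 else 1).
Proof.
move=> /(cbrt_exists_root p_prime b0)[j [u [s [hb s0 hu]]]].
have [c c0 hc] : exists2 c : Qp, c != 0 & q%:R ^ j = c.
  by exists (q%:R ^ j); first exact: expfz_neq0 (padic_prime_neq0 p).
have u0 : residue u != 0 by rewrite hu expf_neq0.
have {}hb : b = c ^+ 3 * u%:F by rewrite hb -hc exprnP exprz_exp.
(* Here |a|^3 < |b|^2 = |c|^6, so a / c^2 reduces to 0 and the rescaled cubic reduces to y^3 = u. *)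
have a'1 : pabs (a / c ^+ 2) < 1.
  rewrite -(@expr_lt1 _ 3) ?pabs_ge0 // pabsM pabsV pabsX exprMn exprVn.
  rewrite ltr_pdivrMr ?exprn_gt0 ?pabs_gt0 // mul1r -exprM.
  move: ab; rewrite hb pabsM pabsX (pabs_unit (u := u)) ?zp_unitE // mulr1.
  by rewrite -exprM.
have /pabs_le1P[z hz] := ltW a'1.
have z0 : residue z = 0 by apply/eqP; rewrite -pabs_lt1 -hz.
have {hz}ha : a = c ^+ 2 * z%:F by rewrite -hz mulrC divfK ?expf_neq0.
have three0 : 3 != 0 :> 'F_q by apply: residue_natr_neq0.
have [||y [hy1 hy2]] := @hensel_cubic 1 z u s.
- by rewrite rmorph1 z0 hu; ring.
- by rewrite rmorph1 z0 addr0 mulr1 mulf_neq0 // expf_neq0.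
have hy : y%:F ^+ 3 + z%:F * y%:F = u%:F.
  by rewrite -hy1 mul1r !(rmorphD, rmorphXn, rmorphM).
have hdelta : - 3 * y%:F ^+ 2 - 4 * z%:F = (- 3 * y ^+ 2 - 4 * z)%:F.
  by rewrite !(rmorphB, rmorphXn, rmorphM, rmorphN, rmorph_nat).
(* Up to the nonzero square s^2 the discriminant reduces to -3, so its square class depends only on
   p modulo 3. *)
have rdelta : residue (- 3 * y ^+ 2 - 4 * z) = - 3 * s ^+ 2.
  by rewrite !(rmorphB, rmorphXn, rmorphM, rmorphN, rmorph_nat) /= hy2 z0; ring.
have neg3 := Fp_neg3_square (pprime_prime p) (pprime_gt3 p_prime p_gt3).
have [h3 h1] := root_list_scale c0 hy; rewrite ha hb.
case: eqP => hp.
  apply: h3; have [t ht] : exists t : 'F_q, t ^+ 2 = - 3.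
    by apply/neg3; rewrite pprimeE.
  have t0 : t != 0 by rewrite -sqrf_eq0 ht oppr_eq0.
  have two0 : 2 != 0 :> 'F_q by apply: residue_natr_neq0.
  have [|w hw] := @hensel_nth_root p 2 (- 3 * y ^+ 2 - 4 * z) (t * s) isT two0
                    (mulf_neq0 t0 s0).
    by rewrite rdelta exprMn ht.
  by exists w%:F; rewrite hdelta -hw rmorphXn.
apply: h1 => -[d]; rewrite hdelta => /esym hd.
have [|w [_ hw]] := padic_sqrt_unit _ hd.
  by rewrite zp_unitE rdelta mulf_neq0 ?expf_neq0 // oppr_eq0.
case: hp; rewrite -(pprimeE p_prime); apply/neg3; exists (residue w / s).
have hw2 : residue w ^+ 2 = - 3 * s ^+ 2 by rewrite -rdelta -hw rmorphXn.
by rewrite exprMn exprVn hw2 mulfK // expf_neq0.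
Qed.

End SmallLinearCoefficient.

(** * The regime |a|^3 = |b|^2 *)

Section BalancedCoefficients.

Variables (a b : Qp).
Hypotheses (a0 : a != 0) (b0 : b != 0) (ab : pabs a ^+ 3 = pabs b ^+ 2).

Lemma balanced_polar : exists (c : Qp) (u v : Zp),
  [/\ c != 0, a = c ^+ 2 * u%:F & b = c ^+ 3 * v%:F] /\
  [/\ residue u != 0, residue v != 0, Dstar a b = - 4 * u%:F ^+ 3 - 27 * v%:F ^+ 2,
    (pdigit a)%:R = residue u & (pdigit b)%:R = residue v].
Proof.
have [u [uu ha pa da]] := punit_polar a0; have [v [vu hb pb db]] := punit_polar b0.
have q1 : 1 < q%:Q by rewrite ltr1n prime_gt1 // pprime_prime.
have e : pval a * 3 = pval b * 2.
  move: ab; rewrite /pabs (negbTE a0) (negbTE b0) !exprnP !exprz_exp.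
  move/(ieexprIz (lt_trans ltr01 q1) (negbT (gt_eqF q1))).
  by rewrite !mulNr => /oppr_inj.
exists (q%:R ^ (pval b - pval a)), u, v; split; split.
- exact: expfz_neq0 (padic_prime_neq0 p).
- rewrite {1}ha exprnP exprz_exp (_ : (pval b - pval a) * 2%:Z = pval a) //.
  by rewrite mulrBl -e; ring.
- rewrite {1}hb exprnP exprz_exp (_ : (pval b - pval a) * 3%:Z = pval b) //.
  by rewrite mulrBl e; ring.
- by rewrite -zp_unitE.
- by rewrite -zp_unitE.
- by rewrite /Dstar pa pb.
- exact: da.
exact: db.
Qed.

Lemma tofrac_discriminant (u v : Zp) :
  (- 4 * u ^+ 3 - 27 * v ^+ 2)%:F = - 4 * u%:F ^+ 3 - 27 * v%:F ^+ 2.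
Proof. by rewrite !(rmorphB, rmorphXn, rmorphM, rmorphN, rmorph_nat). Qed.

Lemma residue_discriminant (u v : Zp) :
  residue (- 4 * u ^+ 3 - 27 * v ^+ 2) = - 4 * residue u ^+ 3 - 27 * residue v ^+ 2.
Proof. by rewrite !(rmorphB, rmorphXn, rmorphM, rmorphN, rmorph_nat). Qed.

Lemma residue_cubic_deriv (u y : Zp) :
  residue (3 * y ^+ 2 + u) = 3 * residue y ^+ 2 + residue u.
Proof. by rewrite rmorphD rmorphM rmorph_nat rmorphXn. Qed.

(** By [cubic_discriminant], D is the discriminant of the cofactor times the square of a nonzero
    derivative, so D decides between three roots and one. *)
Lemma root_list_balanced (c : Qp) (u v y : Zp) :
  c != 0 -> a = c ^+ 2 * u%:F -> b = c ^+ 3 * v%:F ->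
  Dstar a b = - 4 * u%:F ^+ 3 - 27 * v%:F ^+ 2 ->
  y ^+ 3 + u * y = v -> residue (3 * y ^+ 2 + u) != 0 ->
  root_list a b (if sqrt_exists (Dstar a b) then 3 else 1).
Proof.
move=> c0 ha hb hD hy dy0.
have hyF : y%:F ^+ 3 + u%:F * y%:F = v%:F.
  by rewrite -hy !(rmorphD, rmorphXn, rmorphM).
have [h3 h1] := root_list_scale c0 hyF.
have dyF : 3 * y%:F ^+ 2 + u%:F != 0.
  have : (3 * y ^+ 2 + u)%:F != 0 by apply: unit_tofrac_neq0; rewrite zp_unitE.
  by rewrite rmorphD rmorphM rmorph_nat rmorphXn.
have sq : (exists d, - 3 * y%:F ^+ 2 - 4 * u%:F = d ^+ 2) <->
          sqrt_exists (Dstar a b).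
  rewrite sqrt_existsP // hD (cubic_discriminant hyF).
  rewrite [_ * (3 * _ + _) ^+ 2]mulrC; exact: iff_sym (square_scale _ dyF).
rewrite {1}ha {1}hb; case: ifP => h; first by apply: h3; apply/sq.
by apply: h1 => /sq; rewrite h.
Qed.

(** The reduction has a double root, but its remaining root -3 v / u is simple, with derivative -3
    u, and lifts. The case D = 0 is included, since 0 counts as a square. *)
Lemma root_list_balanced_degenerate : pabs (Dstar a b) < 1 ->
  root_list a b (if sqrt_exists (Dstar a b) then 3 else 1).
Proof.
have [c [u [v [[c0 ha hb] [u0 v0 hD _ _]]]]] := balanced_polar.
rewrite {1}hD -tofrac_discriminant pabs_lt1.
rewrite residue_discriminant => /eqP D0.
have three0 : 3 != 0 :> 'F_q by apply: residue_natr_neq0.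
have [e1 e2] := cubic_simple_root u0 D0.
have dy0 : - 3 * residue u != 0 by rewrite mulf_neq0 ?oppr_eq0.
have [||y [hy1 hy2]] := @hensel_cubic 1 u v (- 3 * residue v / residue u).
- by rewrite rmorph1 mul1r.
- by rewrite rmorph1 mulr1 e2.
rewrite mul1r in hy1; apply: root_list_balanced c0 ha hb hD hy1 _.
by rewrite residue_cubic_deriv hy2 e2.
Qed.

Let a0z : int := (pdigit a)%:Z.
Let b0z : int := (pdigit b)%:Z.
Let E : int := D0 a0z b0z * useq a0z b0z (p - 2) ^+ 2.

Lemma root_list_balanced_separable : pabs (Dstar a b) = 1 ->
  ~~ (E == 9 * a0z ^+ 2 %[mod p])%Z ->
  root_list a b (if (E == 0 %[mod p])%Z then 3 else 1).
Proof.
have [c [u [v [[c0 ha hb] [u0 v0 hD da db]]]]] := balanced_polar.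
move=> /eqP; rewrite {1}hD -tofrac_discriminant pabs_eq1.
rewrite residue_discriminant => rD.
have modE m n : (m == n %[mod p])%Z = (m == n %[mod q])%Z by rewrite pprimeE.
have aF : a0z%:~R = residue u by exact: da.
have bF : b0z%:~R = residue v by exact: db.
have [hE h9] := intr_discriminant_test (useq a0z b0z (p - 2)) aF bF.
rewrite (modE E 0) (modE E (9 * a0z ^+ 2)).
rewrite (eqz_modFp p E 0) (eqz_modFp p E (9 * a0z ^+ 2)) [E%:~R]hE h9 rmorph0.
(* D is nonzero modulo p, so [E] vanishes modulo p exactly when [useq] at p - 2 does. *)
rewrite mulf_eq0 (negbTE rD) orFb sqrf_eq0.
have e2 : (q - 2 = p - 2)%N by rewrite pprimeE.
have := cubic_Fp_cases aF bF (pprime_prime p) (pprime_gt3 p_prime p_gt3) v0 rD.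
rewrite e2; set U := (useq _ _ _)%:~R => hcases nE.
have lift r : r ^+ 3 + residue u * r = residue v ->
    root_list a b (if sqrt_exists (Dstar a b) then 3 else 1).
  move=> hr.
  have dr0 : 3 * r ^+ 2 + residue u != 0.
    apply: contraNneq rD => dr0.
    by rewrite (cubic_discriminant hr) dr0 expr0n mulr0.
  have [||y [hy1 hy2]] := @hensel_cubic 1 u v r.
  - by rewrite rmorph1 mul1r.
  - by rewrite rmorph1 mulr1.
  rewrite mul1r in hy1; apply: root_list_balanced c0 ha hb hD hy1 _.
  by rewrite residue_cubic_deriv hy2.
have hDF : Dstar a b = (- 4 * u ^+ 3 - 27 * v ^+ 2)%:F.
  by rewrite hD -tofrac_discriminant.
(* The first two alternatives decide whether D is a square modulo p, hence in Q_p because D is a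
   unit here; [nE] excludes the third. *)
case: hcases => [[U0 [r /lift hr] [s hs]]|[U0 [r /lift hr] hs]|h].
- rewrite U0 eqxx; move: hr; rewrite ifT //; apply/sqrt_existsP => //.
  have two0 : 2 != 0 :> 'F_q by apply: residue_natr_neq0.
  have s0 : s != 0 by apply: contraNneq rD => s0; rewrite -hs s0 expr0n.
  have [|w hw] := @hensel_nth_root p 2 (- 4 * u ^+ 3 - 27 * v ^+ 2) s isT two0 s0.
    by rewrite residue_discriminant hs.
  by exists w%:F; rewrite hDF -hw rmorphXn.
- rewrite (negbTE U0); move: hr; rewrite ifN //; apply/negP => /sqrt_existsP.
  case=> // d; rewrite hDF => /esym hd.
  have [|w [_ hw]] := padic_sqrt_unit _ hd.
    by rewrite zp_unitE residue_discriminant.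
  apply: hs; exists (residue w).
  by rewrite -residue_discriminant -hw rmorphXn.
by rewrite h eqxx in nE.
Qed.

End BalancedCoefficients.

(** * The regime |a|^3 > |b|^2 *)

Section LargeLinearCoefficient.
Variables (a b : Qp).
Hypotheses (a0 : a != 0) (b0 : b != 0) (ab : pabs b ^+ 2 < pabs a ^+ 3).

(** The root [r] is kept apart because its size |b| / |a| is smaller than the size |a|^(1/2) of the
    others, so a region may contain one kind and not the other. *)
Lemma all_roots_large : exists r rs,
  [/\ all_roots (cubic a b) (r :: rs), pabs r * pabs a = pabs b,
    forall s, s \in rs -> pabs s ^+ 2 = pabs a &
    size rs = if sqrt_exists (- a) then 2%N else 0%N].
Proof.
have g1 : pabs (b ^+ 2 / a ^+ 3) < 1.
  by rewrite pabsM pabsV !pabsX ltr_pdivrMr ?mul1r ?exprn_gt0 ?pabs_gt0.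
have /pabs_le1P[g hg] := ltW g1.
have g0 : residue g = 0 by apply/eqP; rewrite -pabs_lt1 -hg.
have [||y [hy1 hy2]] := @hensel_cubic g 1 1 1.
- by rewrite g0 rmorph1 mul0r add0r mulr1.
- by rewrite g0 rmorph1 mulr0 mul0r add0r oner_neq0.
have hyF : b ^+ 2 / a ^+ 3 * y%:F ^+ 3 + y%:F = 1.
  have := congr1 (@FracField.tofrac Zp) hy1.
  by rewrite !(rmorphD, rmorphXn, rmorphM, rmorph1) /= mul1r -hg.
pose r := b / a * y%:F.
have hr : r ^+ 3 + a * r = b := cubic_small_root a0 hyF.
have yu : y \is a GRing.unit by rewrite zp_unitE hy2 oner_neq0.
have rab : pabs r * pabs a = pabs b.
  by rewrite -pabsM /r mulrAC (divfK a0) pabsM (pabs_unit yu) mulr1.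
have two0 : 2 != 0 :> 'F_q by apply: residue_natr_neq0.
(* The discriminant of the cofactor is -a times this factor, which reduces to 4 and is therefore a
   square. *)
have rw : residue (2 ^+ 2 + 3 * (g * y ^+ 2)) = 2 ^+ 2.
  by rewrite rmorphD (rmorphM _ 3) (rmorphM _ g) rmorphXn rmorph_nat /=
             g0 mul0r mulr0 addr0.
have [|w hw] := @hensel_nth_root p 2 (2 ^+ 2 + 3 * (g * y ^+ 2)) 2 isT two0 two0.
  exact: rw.
have w0 : w%:F != 0.
  apply: unit_tofrac_neq0; rewrite zp_unitE -sqrf_eq0 -(rmorphXn (@residue p)) hw.
  by rewrite [_ (_ + _)]rw expf_neq0.
have hw2 : w%:F ^+ 2 = 2 ^+ 2 + 3 * (b ^+ 2 / a ^+ 3 * y%:F ^+ 2).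
  by rewrite -rmorphXn hw hg rmorphD (rmorphM _ 3) (rmorphM _ g) !rmorphXn !rmorph_nat.
have hdelta : - 3 * r ^+ 2 - 4 * a = w%:F ^+ 2 * (- a).
  by rewrite hw2; exact: quotient_discriminant_small_root.
have sq : (exists d, - 3 * r ^+ 2 - 4 * a = d ^+ 2) <-> sqrt_exists (- a).
  by rewrite sqrt_existsP // hdelta; exact: square_scale.
exists r; case: ifP => h.
  have [d hd] := sq.2 h.
  have [s [t [hst hs ht]]] := cubic_all_roots3 hr hd.
  exists [:: s; t]; split=> // x.
  have a_gt0 : 0 < pabs a by rewrite pabs_gt0.
  have ra : pabs r ^+ 2 < pabs a.
    by rewrite -(@ltr_pM2r _ (pabs a ^+ 2)) ?exprn_gt0 // -exprMn rab -exprS.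
  (* Among the alternatives of [cubic_root_pabs], the first would give |z| = |r|, too small for a
     root of the cofactor, and the second contradicts [ab]. *)
  have sz z : z ^+ 2 + r * z + (r ^+ 2 + a) = 0 -> pabs z ^+ 2 = pabs a.
    move=> hz; have az := quadratic_quotient_root_pabs ra hz.
    have := cubic_root_pabs a0 b0 (cubic_eq_quotient hr hz).
    case=> [[hb _]|[_ hab]|[//]]; last by have := lt_trans ab hab; rewrite ltxx.
    have e : pabs z = pabs r by apply: (mulIf (lt0r_neq0 a_gt0)); rewrite -hb rab.
    by have := le_lt_trans az; rewrite e => /(_ _ ra); rewrite ltxx.
  by rewrite !inE => /orP[] /eqP ->; apply: sz.
exists [::]; split=> // A; apply: (nroots_cubic1 hr) => /sq; rewrite h.
exact: notF.
Qed.

End LargeLinearCoefficient.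

End Regimes.

(** * Counting the roots in each region *)

Lemma root_list_nroots p (a b : padic p) n (A : pred (padic p)) :
  root_list a b n -> (forall x, x ^+ 3 + a * x = b -> A x) -> nroots (cubic a b) A n.
Proof.
move=> [rs [<- h hx]] hA; apply: all_roots_nroots h _ => x /hx; exact: hA.
Qed.

Theorem mainTheorem6 (p : nat) (a b : padic p) :
  prime p -> (3 < p)%N -> a != 0 -> b != 0 -> inDelta a b ->
  let a0 : int := (pdigit a)%:Z in
  let b0 : int := (pdigit b)%:Z in
  let D : padic p := Dstar a b in
  let E : int := D0 a0 b0 * useq a0 b0 (p - 2)%N ^+ 2 in
  let A3 : rat := pabs a ^+ 3 in
  let B2 : rat := pabs b ^+ 2 in
  let N (A : pred (padic p)) (n : nat) := nroots (cubic a b) A n in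
  let ZpU : pred (padic p) := fun x => pabs x == 1 in
  let ZpM : pred (padic p) := fun x => pabs x < 1 in
  let QnZ : pred (padic p) := fun x => 1 < pabs x in
  let Qp : pred (padic p) := predT in
  let p1 := (p %% 3 == 1)%N in
  let p2 := (p %% 3 == 2)%N in
  let E0 := (E == 0 %[mod p])%Z in
  let E9 := (E == 9 * a0 ^+ 2 %[mod p])%Z in
  (* N_{Z_p^*} *)
  (((pabs a < pabs b) && (pabs b == 1) && p1 && cbrt_exists b -> N ZpU 3%N) /\
   ((pabs a == 1) && (pabs b == 1) && (pabs D < 1) && sqrt_exists D -> N ZpU 3%N) /\
   ((pabs a == 1) && (pabs b == 1) && (pabs D == 1) && E0 -> N ZpU 3%N) /\
   ((pabs b < pabs a) && (pabs a == 1) && sqrt_exists (- a) -> N ZpU 2%N) /\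
   ((pabs a < pabs b) && (pabs b == 1) && p2 && cbrt_exists b -> N ZpU 1%N) /\
   ((pabs a == 1) && (pabs b == 1) && (0 < pabs D < 1) && ~~ sqrt_exists D -> N ZpU 1%N) /\
   ((pabs a == 1) && (pabs b == 1) && (pabs D == 1) && ~~ E0 && ~~ E9 -> N ZpU 1%N) /\
   ((pabs a == pabs b) && (1 < pabs b) -> N ZpU 1%N)) /\
  (* N_{Z_p \ Z_p^*} *)
  (((A3 < B2 < 1) && p1 && cbrt_exists b -> N ZpM 3%N) /\
   ((A3 == B2) && (B2 < 1) && (pabs D < 1) && sqrt_exists D -> N ZpM 3%N) /\
   ((A3 == B2) && (B2 < 1) && (pabs D == 1) && E0 -> N ZpM 3%N) /\
   ((B2 < A3 < 1) && sqrt_exists (- a) -> N ZpM 3%N) /\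
   ((A3 < B2 < 1) && p2 && cbrt_exists b -> N ZpM 1%N) /\
   ((A3 == B2) && (B2 < 1) && (0 < pabs D < 1) && ~~ sqrt_exists D -> N ZpM 1%N) /\
   ((A3 == B2) && (B2 < 1) && (pabs D == 1) && ~~ E0 && ~~ E9 -> N ZpM 1%N) /\
   ((B2 < A3 < 1) && ~~ sqrt_exists (- a) -> N ZpM 1%N) /\
   ((B2 < A3) && (pabs b < pabs a) && (1 <= pabs a) -> N ZpM 1%N)) /\
  (* N_{Q_p \ Z_p} *)
  (((A3 < B2) && (1 < pabs b) && p1 && cbrt_exists b -> N QnZ 3%N) /\
   ((A3 == B2) && (1 < B2) && (pabs D < 1) && sqrt_exists D -> N QnZ 3%N) /\
   ((A3 == B2) && (1 < B2) && (pabs D == 1) && E0 -> N QnZ 3%N) /\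
   ((B2 < A3) && (pabs a < pabs b) && sqrt_exists (- a) -> N QnZ 3%N) /\
   ((B2 < A3) && (pabs b <= pabs a) && (1 < pabs a) && sqrt_exists (- a) -> N QnZ 2%N) /\
   ((A3 < B2) && (1 < pabs b) && p2 && cbrt_exists b -> N QnZ 1%N) /\
   ((A3 == B2) && (1 < B2) && (0 < pabs D < 1) && ~~ sqrt_exists D -> N QnZ 1%N) /\
   ((A3 == B2) && (1 < B2) && (pabs D == 1) && ~~ E0 && ~~ E9 -> N QnZ 1%N) /\
   ((B2 < A3) && (pabs a < pabs b) && ~~ sqrt_exists (- a) -> N QnZ 1%N)) /\
  (* N_{Q_p} *)
  (((A3 < B2) && p1 && cbrt_exists b -> N Qp 3%N) /\
   ((A3 == B2) && (pabs D < 1) && sqrt_exists D -> N Qp 3%N) /\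
   ((A3 == B2) && (pabs D == 1) && E0 -> N Qp 3%N) /\
   ((B2 < A3) && sqrt_exists (- a) -> N Qp 3%N) /\
   ((A3 < B2) && p2 && cbrt_exists b -> N Qp 1%N) /\
   ((A3 == B2) && (0 < pabs D < 1) && ~~ sqrt_exists D -> N Qp 1%N) /\
   ((A3 == B2) && (pabs D == 1) && ~~ E0 && ~~ E9 -> N Qp 1%N) /\
   ((B2 < A3) && ~~ sqrt_exists (- a) -> N Qp 1%N)).
Proof.
move=> p_prime p_gt3 a0 b0 ab_Delta a0z b0z D E A3 B2 N ZpU ZpM QnZ Qp p1 p2 E0 E9.
have a_gt0 : 0 < pabs a by rewrite pabs_gt0.
have b_gt0 : 0 < pabs b by rewrite pabs_gt0.
have [a_ge0 b_ge0] := (ltW a_gt0, ltW b_gt0).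
have lt1X (x : rat) n : 0 <= x -> (x ^+ n.+1 < 1) = (x < 1) by move=> x0; rewrite expr_lt1.
have gt1X (x : rat) n : 0 <= x -> (1 < x ^+ n.+1) = (1 < x) by move=> x0; rewrite expr_gt1.
have eq1X (x : rat) n : 0 <= x -> (x ^+ n.+1 == 1) = (x == 1).
  by move=> x0; rewrite pexpr_eq1.
(* The facts [small], [degenerate], [separable] and [large] count roots in an arbitrary region [A];
   the listed cases then only require locating absolute values. *)
have small (A : pred (padic p)) : A3 < B2 -> cbrt_exists b ->
    (forall x, pabs x ^+ 3 = pabs b -> A x) -> N A (if p1 then 3 else 1)%N.
  move=> ab cb hA.
  apply: root_list_nroots (root_list_small p_prime p_gt3 b0 ab cb) _ => x hx.
  case: (cubic_root_pabs a0 b0 hx) => [[_ h]|[h _]|[_ h]]; last 2 first.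
  - exact: hA.
  - by move: (lt_le_trans ab h); rewrite ltxx.
  by move: (lt_trans ab h); rewrite ltxx.
have balanced_abs (x : padic p) : A3 == B2 -> x ^+ 3 + a * x = b -> pabs x ^+ 2 = pabs a.
  move=> /eqP ab hx; case: (cubic_root_pabs a0 b0 hx) => [[_]|[_]|[//]].
    by rewrite -/A3 -/B2 ab ltxx.
  by rewrite -/A3 -/B2 ab ltxx.
have degenerate (A : pred (padic p)) : A3 == B2 -> pabs D < 1 ->
    (forall x, pabs x ^+ 2 = pabs a -> A x) -> N A (if sqrt_exists D then 3 else 1)%N.
  move=> ab Dlt hA.
  have := root_list_balanced_degenerate p_prime p_gt3 a0 b0 (eqP ab) Dlt.
  by move/root_list_nroots; apply=> x hx; apply/hA/balanced_abs.
have separable (A : pred (padic p)) : A3 == B2 -> pabs D == 1 ->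
    (forall x, pabs x ^+ 2 = pabs a -> A x) -> N A (if E0 then 3 else 1)%N.
  move=> ab /eqP D1 hA.
  (* When |a|^3 = |b|^2, only the middle clause of [inDelta] can hold. *)
  have nE9 : ~~ E9.
    move: ab_Delta; rewrite /inDelta -/A3 -/B2 (eqP ab) ltxx eqxx /= orbF.
    exact: id.
  have := root_list_balanced_separable p_prime p_gt3 a0 b0 (eqP ab) D1 nE9.
  by move/root_list_nroots; apply=> x hx; apply/hA/balanced_abs.
(* The booleans [c1] and [c2] record whether [A] contains the small root and the other two roots, if
   these exist. *)
have large (A : pred (padic p)) (c1 c2 : bool) : B2 < A3 ->
    (forall x, pabs x * pabs a = pabs b -> A x = c1) ->
    (forall x, pabs x ^+ 2 = pabs a -> A x = c2) ->
    N A (c1 + (if sqrt_exists (- a) then 2 * c2 else 0))%N.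
  move=> ab h1 h2.
  have [r [rs [hrs hr hs sz]]] := all_roots_large p_prime p_gt3 a0 b0 ab.
  have := hrs A; rewrite /= (h1 _ hr).
  suff -> : count A rs = (if sqrt_exists (- a) then 2 * c2 else 0)%N by [].
  rewrite (@eq_in_count _ _ (fun=> c2)); last by move=> s /hs /h2.
  case: (c2); last by rewrite count_pred0 muln0 if_same.
  by rewrite count_predT sz muln1.
have divlt (x : padic p) : pabs x * pabs a = pabs b -> (pabs x < 1) = (pabs b < pabs a).
  by move=> <-; rewrite gtr_pMl.
have divgt (x : padic p) : pabs x * pabs a = pabs b -> (1 < pabs x) = (pabs a < pabs b).
  by move=> <-; rewrite ltr_pMl.
have diveq (x : padic p) : pabs x * pabs a = pabs b -> (pabs x == 1) = (pabs b == pabs a).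
  move=> <-; rewrite -{2}[pabs a]mul1r (inj_eq (mulIf _)) //.
  exact: lt0r_neq0.
have px (x : padic p) : 0 <= pabs x by exact: pabs_ge0.
have sqlt (x : padic p) : pabs x ^+ 2 = pabs a -> (pabs x < 1) = (pabs a < 1).
  by move=> <-; rewrite (lt1X _ 1%N (px x)).
have sqgt (x : padic p) : pabs x ^+ 2 = pabs a -> (1 < pabs x) = (1 < pabs a).
  by move=> <-; rewrite (gt1X _ 1%N (px x)).
have sqeq (x : padic p) : pabs x ^+ 2 = pabs a -> (pabs x == 1) = (pabs a == 1).
  by move=> <-; rewrite (eq1X _ 1%N (px x)).
have sm1 (x : padic p) : pabs x ^+ 3 = pabs b -> (pabs x == 1) = (pabs b == 1).
  by move=> <-; rewrite (eq1X _ 2%N (px x)).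
have sm2 (x : padic p) : pabs x ^+ 3 = pabs b -> (pabs x < 1) = (pabs b < 1).
  by move=> <-; rewrite (lt1X _ 2%N (px x)).
have sm3 (x : padic p) : pabs x ^+ 3 = pabs b -> (1 < pabs x) = (1 < pabs b).
  by move=> <-; rewrite (gt1X _ 2%N (px x)).
have p21 : p2 -> p1 = false by rewrite /p1 => /eqP ->.
have units_balanced : pabs a == 1 -> pabs b == 1 -> A3 == B2.
  by move=> /eqP ha /eqP hb; rewrite /A3 /B2 ha hb !expr1n.
have unit_small : pabs a < pabs b -> pabs b == 1 -> A3 < B2.
  by move=> h /eqP hb; rewrite /A3 /B2 hb expr1n lt1X // -hb.
have ble : B2 < 1 -> pabs b < 1 by rewrite lt1X.
have bal_lt : A3 == B2 -> B2 < 1 -> pabs a < 1 by move=> /eqP <-; rewrite lt1X.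
have bal_gt : A3 == B2 -> 1 < B2 -> 1 < pabs a by move=> /eqP <-; rewrite gt1X.
split; [|split; [|split]].
- split; [|split; [|split; [|split; [|split; [|split; [|split]]]]]].
  + move=> /andP[/andP[/andP[h1 h2] h3] h4].
    have := small ZpU (unit_small h1 h2) h4; rewrite h3; apply=> x /sm1 e.
    by rewrite /ZpU e.
  + move=> /andP[/andP[/andP[h1 h2] h3] h4].
    have := degenerate ZpU (units_balanced h1 h2) h3; rewrite h4; apply=> x /sqeq e.
    by rewrite /ZpU e.
  + move=> /andP[/andP[/andP[h1 h2] h3] h4].
    have := separable ZpU (units_balanced h1 h2) h3; rewrite h4; apply=> x /sqeq e.
    by rewrite /ZpU e.
  + move=> /andP[/andP[h1 h2] h3].
    have ab : B2 < A3.
      by rewrite /A3 /B2 (eqP h2) expr1n lt1X // -(eqP h2).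
    have := large ZpU false true ab; rewrite h3; apply=> x.
      by rewrite /ZpU => /diveq ->; rewrite lt_eqF.
    by rewrite /ZpU => /sqeq ->.
  + move=> /andP[/andP[/andP[h1 h2] h3] h4].
    have := small ZpU (unit_small h1 h2) h4; rewrite p21 //; apply=> x /sm1 e.
    by rewrite /ZpU e.
  + move=> /andP[/andP[/andP[h1 h2] /andP[_ h3]] h4].
    have := degenerate ZpU (units_balanced h1 h2) h3.
    rewrite (negbTE h4); apply=> x /sqeq e.
    by rewrite /ZpU e.
  + move=> /andP[/andP[/andP[/andP[h1 h2] h3] h4] _].
    have := separable ZpU (units_balanced h1 h2) h3.
    rewrite (negbTE h4); apply=> x /sqeq e.
    by rewrite /ZpU e.
  + move=> /andP[/eqP h1 h2].
    have ab : B2 < A3.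
      by rewrite /A3 /B2 h1 [_ ^+ 3]exprS ltr_pMl // exprn_gt0.
    (* The small root has absolute value |b| / |a| = 1 and any others exceed 1, so the count does
       not depend on the square root of -a. *)
    have := large ZpU true false ab; rewrite muln0 if_same; apply=> x.
      by rewrite /ZpU => /diveq ->; rewrite h1 eqxx.
    by rewrite /ZpU => /sqeq ->; rewrite h1 gt_eqF.
- split; [|split; [|split; [|split; [|split; [|split; [|split; [|split]]]]]]].
  + move=> /andP[/andP[/andP[h1 h2] h3] h4].
    have := small ZpM h1 h4; rewrite h3; apply=> x /sm2 e.
    by rewrite /ZpM e ble.
  + move=> /andP[/andP[/andP[h1 h2] h3] h4].
    have := degenerate ZpM h1 h3; rewrite h4; apply=> x /sqlt e.
    by rewrite /ZpM e bal_lt.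
  + move=> /andP[/andP[/andP[h1 h2] h3] h4].
    have := separable ZpM h1 h3; rewrite h4; apply=> x /sqlt e.
    by rewrite /ZpM e bal_lt.
  + move=> /andP[/andP[h1 h2] h3].
    have a1 : pabs a < 1 by rewrite -(lt1X _ 2%N a_ge0).
    (* Since |a| < 1, |b|^2 < |a|^3 < |a|^2. *)
    have ba : pabs b < pabs a.
      rewrite -(@ltr_pXn2r _ 2) ?nnegrE // (lt_trans h1) //.
      by rewrite /A3 exprS gtr_pMl // exprn_gt0.
    have := large ZpM true true h1; rewrite h3; apply=> x.
      by rewrite /ZpM => /divlt ->.
    by rewrite /ZpM => /sqlt ->.
  + move=> /andP[/andP[/andP[h1 h2] h3] h4].
    have := small ZpM h1 h4; rewrite p21 //; apply=> x /sm2 e.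
    by rewrite /ZpM e ble.
  + move=> /andP[/andP[/andP[h1 h2] /andP[_ h3]] h4].
    have := degenerate ZpM h1 h3; rewrite (negbTE h4); apply=> x /sqlt e.
    by rewrite /ZpM e bal_lt.
  + move=> /andP[/andP[/andP[/andP[h1 h2] h3] h4] _].
    have := separable ZpM h1 h3; rewrite (negbTE h4); apply=> x /sqlt e.
    by rewrite /ZpM e bal_lt.
  + move=> /andP[/andP[h1 h2] h3].
    have a1 : pabs a < 1 by rewrite -(lt1X _ 2%N a_ge0).
    have ba : pabs b < pabs a.
      rewrite -(@ltr_pXn2r _ 2) ?nnegrE // (lt_trans h1) //.
      by rewrite /A3 exprS gtr_pMl // exprn_gt0.
    have := large ZpM true true h1; rewrite (negbTE h3); apply=> x.
      by rewrite /ZpM => /divlt ->.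
    by rewrite /ZpM => /sqlt ->.
  + move=> /andP[/andP[h1 h2] h3].
    have := large ZpM true false h1; rewrite muln0 if_same; apply=> x.
      by rewrite /ZpM => /divlt ->.
    by rewrite /ZpM => /sqlt ->; rewrite ltNge h3.
- split; [|split; [|split; [|split; [|split; [|split; [|split; [|split]]]]]]].
  + move=> /andP[/andP[/andP[h1 h2] h3] h4].
    have := small QnZ h1 h4; rewrite h3; apply=> x /sm3 e.
    by rewrite /QnZ e.
  + move=> /andP[/andP[/andP[h1 h2] h3] h4].
    have := degenerate QnZ h1 h3; rewrite h4; apply=> x /sqgt e.
    by rewrite /QnZ e bal_gt.
  + move=> /andP[/andP[/andP[h1 h2] h3] h4].
    have := separable QnZ h1 h3; rewrite h4; apply=> x /sqgt e.
    by rewrite /QnZ e bal_gt.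
  + move=> /andP[/andP[h1 h2] h3].
    (* From |a|^2 < |b|^2 < |a|^3. *)
    have a1 : 1 < pabs a.
      rewrite -(@ltr_pM2r _ (pabs a ^+ 2)) ?exprn_gt0 // mul1r -exprS.
      by rewrite (lt_trans _ h1) // ltr_pXn2r ?nnegrE.
    have := large QnZ true true h1; rewrite h3; apply=> x.
      by rewrite /QnZ => /divgt ->.
    by rewrite /QnZ => /sqgt ->.
  + move=> /andP[/andP[/andP[h1 h2] h3] h4].
    have := large QnZ false true h1; rewrite h4; apply=> x.
      by rewrite /QnZ => /divgt ->; rewrite ltNge h2.
    by rewrite /QnZ => /sqgt ->.
  + move=> /andP[/andP[/andP[h1 h2] h3] h4].
    have := small QnZ h1 h4; rewrite p21 //; apply=> x /sm3 e.
    by rewrite /QnZ e.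
  + move=> /andP[/andP[/andP[h1 h2] /andP[_ h3]] h4].
    have := degenerate QnZ h1 h3; rewrite (negbTE h4); apply=> x /sqgt e.
    by rewrite /QnZ e bal_gt.
  + move=> /andP[/andP[/andP[/andP[h1 h2] h3] h4] _].
    have := separable QnZ h1 h3; rewrite (negbTE h4); apply=> x /sqgt e.
    by rewrite /QnZ e bal_gt.
  + move=> /andP[/andP[h1 h2] h3].
    have a1 : 1 < pabs a.
      rewrite -(@ltr_pM2r _ (pabs a ^+ 2)) ?exprn_gt0 // mul1r -exprS.
      by rewrite (lt_trans _ h1) // ltr_pXn2r ?nnegrE.
    have := large QnZ true true h1; rewrite (negbTE h3); apply=> x.
      by rewrite /QnZ => /divgt ->.
    by rewrite /QnZ => /sqgt ->.
- split; [|split; [|split; [|split; [|split; [|split; [|split]]]]]].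
  + move=> /andP[/andP[h1 h3] h4].
    by have := small Qp h1 h4; rewrite h3; apply.
  + move=> /andP[/andP[h1 h3] h4].
    by have := degenerate Qp h1 h3; rewrite h4; apply.
  + move=> /andP[/andP[h1 h3] h4].
    by have := separable Qp h1 h3; rewrite h4; apply.
  + move=> /andP[h1 h3].
    by have := large Qp true true h1; rewrite h3; apply.
  + move=> /andP[/andP[h1 h3] h4].
    by have := small Qp h1 h4; rewrite p21 //; apply.
  + move=> /andP[/andP[h1 /andP[_ h3]] h4].
    by have := degenerate Qp h1 h3; rewrite (negbTE h4); apply.
  + move=> /andP[/andP[/andP[h1 h3] h4] _].
    by have := separable Qp h1 h3; rewrite (negbTE h4); apply.
  + move=> /andP[h1 h3].
    by have := large Qp true true h1; rewrite (negbTE h3); apply.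
Qed.
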